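(* Let $Q$ be a finite connected quiver without oriented cycles (equivalently, let $Q = Q_B$ be given by a skew-symmetric integral matrix $B$, so that $Q$ defines an acyclic cluster algebra). Then the following are equivalent: (a) The mutation class of $Q$ is finite, i.e. up to isomorphism of quivers only finitely many quivers can be obtained from $Q$ by finite sequences of mutations. (b) $Q$ is Dynkin, or $Q$ is extended Dynkin, or $Q$ has at most two vertices.
   Context: A skew-symmetric integral $n\times n$ matrix $B=(b_{ij})$ corresponds to a finite quiver $Q_B$ with vertices $1,\dots,n$, without loops or oriented cycles of length two: if $b_{ij}>0$ there are exactly $b_{ij}$ arrows from $i$ to $j$ (multiple arrows are allowed). For $1\le k\le n$ the mutation of $B$ in direction $k$ is the skew-symmetric matrix $\mu_k(B)=B'=(b'_{ij})$ given by $$b'_{ij}=\begin{cases}-b_{ij} & \text{if } i=k \text{ or } j=k,\\ b_{ij}+\tfrac12\left(|b_{ik}|\,b_{kj}+b_{ik}\,|b_{kj}|\right) & \text{otherwise.}\end{cases}$$ The mutation of $Q_B$ in direction $k$ is the quiver $Q_{\mu_k(B)}$. The mutation class of $Q$ is the set of all quivers which can be reached from $Q$ by a finite number of mutations; it is considered up to isomorphism of quivers. A quiver is Dynkin if its underlying graph is one of the (simply laced) Dynkin diagrams $A_n$ ($n\ge1$), $D_n$ ($n\ge4$), $E_6,E_7,E_8$. It is extended Dynkin if its underlying graph is one of the (simply laced) extended Dynkin diagrams $\tilde A_n$ ($n\ge1$; a cycle with $n+1$ vertices, where $\tilde A_1$ is two vertices joined by two edges), $\tilde D_n$ ($n\ge4$),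 $\tilde E_6,\tilde E_7,\tilde E_8$. A cluster algebra is called acyclic if one of the matrices occurring in its seeds corresponds to a quiver without oriented cycles. *)

(* Defs.v *)
From HB Require Import structures.
From mathcomp Require Import all_boot all_order all_algebra.
From mathcomp Require Import perm.

Set Implicit Arguments.
Unset Strict Implicit.
Unset Printing Implicit Defensive.

Import Order.TTheory GRing.Theory Num.Theory.
Local Open Scope ring_scope.

Definition skew_symmetric n (B : 'M[int]_n) : Prop := B^T = - B.

(* A quiver on the vertex set 'I_n without loops or oriented 2-cycles is       *)
(* represented by its skew-symmetric matrix B: narrows B i j is the number of  *)
(* arrows from i to j in Q_B, and nedges B i j is the number of edges joining  *)
(* i and j in the underlying graph.                                            *)
Definition narrows n (B : 'M[int]_n) (i j : 'I_n) : nat :=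
  if 0 < B i j then `|B i j|%N else 0%N.

Definition nedges n (B : 'M[int]_n) (i j : 'I_n) : nat :=
  (narrows B i j + narrows B j i)%N.

Definition quiver_iso n (B C : 'M[int]_n) : Prop :=
  exists s : {perm 'I_n}, forall i j, narrows C (s i) (s j) = narrows B i j.

Definition quiver_connected n (B : 'M[int]_n) : Prop :=
  (0 < n)%N /\ forall i j : 'I_n, connect [rel x y | (0 < nedges B x y)%N] i j.

Definition quiver_acyclic n (B : 'M[int]_n) : Prop :=
  forall c : seq 'I_n, cycle [rel x y | (0 < narrows B x y)%N] c -> c = [::].

(* Integer division by 2; it is exact by mutation_half_exact.                  *)
Definition mutation n (k : 'I_n) (B : 'M[int]_n) : 'M[int]_n :=
  \matrix_(i, j)
    if (i == k) || (j == k) then - B i j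
    else B i j + ((`|B i k| * B k j + B i k * `|B k j|) %/ 2)%Z.

Lemma mutation_half_exact (a b : int) :
  2 * ((`|a| * b + a * `|b|) %/ 2)%Z = `|a| * b + a * `|b|.
Proof.
rewrite mulrC divzK //.
have dvd2 (x : int) : (2 %| x + x)%Z.
  by apply/dvdzP; exists x; rewrite mulrDr mulr1.
case: (ger0P a) => _; case: (ger0P b) => _.
- exact: dvd2.
- by rewrite mulrN subrr.
- by rewrite mulNr addNr.
- by rewrite mulNr mulrN; apply: dvd2.
Qed.

Definition in_mutation_class n (B C : 'M[int]_n) : Prop :=
  exists ks : seq 'I_n, C = foldl (fun M k => mutation k M) B ks.

Definition mutation_class_finite n (B : 'M[int]_n) : Prop :=
  exists reps : seq 'M[int]_n, forall C : 'M[int]_n,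
    in_mutation_class B C -> exists2 R, R \in reps & quiver_iso C R.

Local Open Scope nat_scope.

(* A diagram is a number n of vertices, labelled 0, ..., n - 1, together with  *)
(* a list of unordered edges, repeated according to multiplicity.              *)
Definition diagram_mult (es : seq (nat * nat)) (i j : nat) : nat :=
  count (fun e => (e == (i, j)) || (e == (j, i))) es.

Definition chain (n : nat) : seq (nat * nat) :=
  [seq (i, i.+1) | i <- iota 0 n.-1].

Inductive dynkin_diagram : nat -> seq (nat * nat) -> Prop :=
| Dynkin_A n of (1 <= n) : dynkin_diagram n (chain n)
| Dynkin_D n of (4 <= n) :
    dynkin_diagram n (chain n.-1 ++ [:: (n - 3, n - 1)])
| Dynkin_E6 : dynkin_diagram 6 (chain 5 ++ [:: (2, 5)])
| Dynkin_E7 : dynkin_diagram 7 (chain 6 ++ [:: (2, 6)])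
| Dynkin_E8 : dynkin_diagram 8 (chain 7 ++ [:: (2, 7)]).

(* The diagrams of index n below have n + 1 vertices. For n = 1 the edge list  *)
(* of the first family is [:: (0, 1); (1, 0)], a double edge.                  *)
Inductive extended_dynkin_diagram : nat -> seq (nat * nat) -> Prop :=
| ExtDynkin_A n of (1 <= n) :
    extended_dynkin_diagram n.+1 (chain n.+1 ++ [:: (n, 0)])
| ExtDynkin_D n of (4 <= n) :
    extended_dynkin_diagram n.+1
      (chain n.-1 ++ [:: (1, n - 1); (n - 3, n)])
| ExtDynkin_E6 : extended_dynkin_diagram 7 (chain 5 ++ [:: (2, 5); (5, 6)])
| ExtDynkin_E7 : extended_dynkin_diagram 8 (chain 7 ++ [:: (3, 7)])
| ExtDynkin_E8 : extended_dynkin_diagram 9 (chain 8 ++ [:: (2, 8)]).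

Definition underlying_graph_is n (B : 'M[int]_n) (es : seq (nat * nat)) : Prop :=
  exists s : {perm 'I_n}, forall i j : 'I_n,
    nedges B i j = diagram_mult es (s i) (s j).

Definition quiver_dynkin n (B : 'M[int]_n) : Prop :=
  exists2 es, dynkin_diagram n es & underlying_graph_is B es.

Definition quiver_extended_dynkin n (B : 'M[int]_n) : Prop :=
  exists2 es, extended_dynkin_diagram n es & underlying_graph_is B es.

(* Main.v *)
Require Import Defs.
From Stdlib Require Import NArith PArith FMapPositive.
From mathcomp Require Import all_boot all_order all_algebra.
From mathcomp Require Import perm zify ring lra.

(* The mutation class is finite if and only if the entries of its matrices    *)
(* are bounded.                                                               *)
(*                                                                            *)
(* (a) => (b): let delta >= 0 satisfy 2 delta_k <= sum_j |b_kj| delta_j on    *)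
(* its support S, and let x outside S be joined to S.  Mutating along a       *)
(* topological ordering of S only mutates at sources of S, so a full sweep    *)
(* restores the quiver on S, while sum_j delta_j b_xj never decreases.  It    *)
(* increases strictly in the first sweep, for Q or for the opposite quiver.   *)
(* If the entries were bounded, the sweeps would be periodic, which is        *)
(* absurd.  Additive functions of extended Dynkin diagrams are such delta,    *)
(* so the graph contains no extended Dynkin diagram properly, and looking at  *)
(* a longest path gives the classification.                                   *)
(*                                                                            *)
(* (b) => (a): quivers of type A, D and of the extended types are given by    *)
(* triangulations of surfaces with at most two punctures; a mutation is a     *)
(* flip, and all entries are at most 2 in absolute value.  For the types E    *)
(* the mutation class, up to isomorphism and sign, is enumerated by a         *)
(* computation, and its closure under mutation is checked.                    *)

Set Implicit Arguments.
Unset Strict Implicit.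
Unset Printing Implicit Defensive.

(** * Graphs *)

(** Both directions pass through the entries: a mutation class is finite up to isomorphism exactly
    when its matrices have a common bound on their entries ([mutation_class_finite_bounded],
    [bounded_mutation_class_finite]).

    From finiteness to the diagrams: let [delta] satisfy 2 delta_k <= sum_j |b_kj| delta_j on its
    support S, and let x lie outside S. If k is a source of S, mutating at k changes sum_j delta_j
    b_xj by [b_xk]_+ sum_j |b_kj| delta_j - 2 delta_k b_xk, which is at least 2 delta_k [-b_xk]_+ >=
    0 ([potential_mutation]). A sweep through S in topological order meets only sources and restores
    S, so it can be iterated. Mutations are injective, so under a bound on the entries the iteration
    is periodic, and one strict increase is a contradiction ([no_subadditive]). Hence on a connected
    acyclic quiver with bounded class no such [delta] has a proper nonempty support. With at least
    three vertices, this forces a Dynkin or extended Dynkin graph ([graph_classified]).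

    From the diagrams to finiteness: matrices of triangulations are closed under mutation
    ([triangulated_mutation]) and have entries at most 2 in absolute value ([triangulated_le2]). All
    orientations of A, D, extended D and of cycles with at least three vertices are of this kind.
    For the six E diagrams, a finite list closed under mutation up to sign and relabelling is
    checked by computation ([valid_bounded]). On at most two vertices a mutation only changes signs
    ([bounded_le2]). *)

Lemma diagram_mult_chain m a b : a <= b ->
  diagram_mult (chain m) a b = (b == a.+1) && (b < m).
Proof.
move=> ab; rewrite /diagram_mult /chain count_map.
rewrite (eq_count (a2 := fun i => (i == a) && (b == a.+1))).
  case: eqP => [->|ba] /=; last by under eq_count do rewrite andbF; rewrite count_pred0.
  under eq_count do rewrite andbT; rewrite count_uniq_mem ?iota_uniq // mem_iota /=.
  by congr (nat_of_bool _); lia.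
by move=> i /=; rewrite !xpair_eqE; lia.
Qed.

Lemma diagram_multC es a b : diagram_mult es a b = diagram_mult es b a.
Proof. by apply: eq_count => x; rewrite orbC. Qed.

Lemma diagram_mult_cons e es a b :
  diagram_mult (e :: es) a b = ((e == (a, b)) || (e == (b, a))) + diagram_mult es a b.
Proof. by []. Qed.

Lemma diagram_mult_cat es es' a b :
  diagram_mult (es ++ es') a b = diagram_mult es a b + diagram_mult es' a b.
Proof. exact: count_cat. Qed.

(* The additive function of the extended diagram D on a path of [L] vertices   *)
(* with one more vertex, [L] and [L + 1], attached next to each end.          *)
Definition forked_weight L a := if (0 < a) && (a < L - 1) then 2 else 1.

Definition forked_neighbours L a :=
  if a == 0 then [:: 1] else if a == L - 1 then [:: L - 2] else
  if a == L then [:: 1] else if a == L.+1 then [:: L - 2] else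
  [:: a.-1; a.+1] ++ (if a == 1 then [:: L] else [::])
                  ++ (if a == L - 2 then [:: L.+1] else [::]).

(** A leaf, of weight 1, sees a vertex of weight 2. A vertex of weight 2 sees total weight at least
    4, because the two leaves at a fork count as one more vertex of weight 2. *)
Lemma forked_weights L a : 3 <= L -> a < L.+2 ->
  [/\ 0 < forked_weight L a, uniq (forked_neighbours L a),
      2 * forked_weight L a <= \sum_(b <- forked_neighbours L a) forked_weight L b &
      all (fun b => (b < L.+2) &&
        (0 < diagram_mult (chain L ++ [:: (1, L); (L - 2, L.+1)]) a b))
        (forked_neighbours L a)].
Proof.
move=> L3 aL; set es := _ ++ _.
have mA b b' : b <= b' -> b' < L.+2 ->
    (b' == b.+1) && (b' < L) || (b == 1) && (b' == L) || (b == L - 2) && (b' == L.+1) ->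
    0 < diagram_mult es b b'.
  move=> bb bL hb.
  by rewrite diagram_mult_cat diagram_mult_chain // /diagram_mult /= !xpair_eqE; lia.
have mA' b b' : b <= b' -> b' < L.+2 ->
    (b' == b.+1) && (b' < L) || (b == 1) && (b' == L) || (b == L - 2) && (b' == L.+1) ->
    0 < diagram_mult es b' b.
  by rewrite diagram_multC; apply: mA.
rewrite /forked_weight /forked_neighbours; case: (eqVneq a 0) => [->|a0].
  have L1 : 0 < 1 < L - 1 by lia.
  split=> //; first by rewrite big_seq1 L1.
  by rewrite /= andbT; apply: mA; lia.
have e2 : (0 < L - 2 < L - 1) = true by lia.
case: (eqVneq a (L - 1)) => [->|aL1].
  have e1 : (0 < L - 1 < L - 1) = false by lia.
  split=> //; rewrite ?big_seq1 ?e1 ?e2 //.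
  by rewrite /= andbT; apply/andP; split; [lia|apply: mA'; lia].
case: (eqVneq a L) => [->|aL2].
  have e1 : (0 < L < L - 1) = false by lia.
  have e3 : (0 < 1 < L - 1) = true by lia.
  split=> //; rewrite ?big_seq1 ?e1 ?e3 //.
  by rewrite /= andbT; apply: mA'; lia.
case: (eqVneq a L.+1) => [->|aL3].
  have e1 : (0 < L.+1 < L - 1) = false by lia.
  split=> //; rewrite ?big_seq1 ?e1 ?e2 //.
  by rewrite /= andbT; apply/andP; split; [lia|apply: mA'; lia].
split; first by case: ifP.
- by case: ifP => _; case: ifP => _; rewrite /= !inE; lia.
- have e3 : (0 < a < L - 1) = true by lia.
  have e4 : (0 < a.-1 < L - 1) = (a != 1) by lia.
  have e5 : (a.+1 < L - 1) = (a != L - 2) by lia.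
  have e6 : (0 < L < L - 1) = false by lia.
  have e7 : (L.+1 < L - 1) = false by lia.
  rewrite !(big_cons, big_cat, big_nil) /= e3 e4 e5.
  by case: (a == 1); case: (a == L - 2); rewrite ?big_seq1 ?big_nil ?e6 ?e7.
apply/allP => b; rewrite !inE mem_cat => /or3P[/eqP->|/eqP->|].
- by apply/andP; split; [lia|apply: mA'; lia].
- by apply/andP; split; [lia|apply: mA; lia].
- by case/orP; case: (eqVneq a _) => // aE; rewrite inE => /eqP ->;
    apply/andP; (split; [lia|apply: mA; lia]).
Qed.

(** * Connected graphs without subadditive functions of proper support *)

Section Graph.
Variables (n : nat) (e : 'I_n -> 'I_n -> nat) (x0 : 'I_n).
Let adj := [rel i j : 'I_n | 0 < e i j].
Hypothesis eC : forall i j, e i j = e j i.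
Hypothesis e0 : forall i, e i i = 0.
Hypothesis e_conn : forall i j, connect adj i j.
Hypothesis n_ge3 : 3 <= n.
Hypothesis e_sub : forall (delta : 'I_n -> nat) x k, delta x = 0 -> 0 < delta k ->
  (forall k, 0 < delta k -> 2 * delta k <= \sum_j e k j * delta j) -> False.

Implicit Types (c s q : seq 'I_n) (y : 'I_n).

Local Notation "c .[ a ]" := (nth x0 c a).

(** Extended by 0 outside [c], the weights contradict [e_sub] as soon as a vertex is missing from
    [c]. The list [nb a] need only consist of distinct neighbours, so multiplicities and further
    edges never have to be computed. *)
Lemma weights_full (c : seq 'I_n) (w : nat -> nat) (nb : nat -> seq nat) :
  uniq c -> c != [::] ->
  (forall a, a < size c -> [/\ 0 < w a, uniq (nb a),
     2 * w a <= \sum_(b <- nb a) w b &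
     all (fun b => (b < size c) && adj c.[a] c.[b]) (nb a)]) ->
  forall x, x \in c.
Proof.
move=> cu c0 cw x; apply/negPn/negP => xc.
pose delta v := if v \in c then w (index v c) else 0.
have deltaE a : a < size c -> delta c.[a] = w a.
  by move=> ac; rewrite /delta mem_nth // index_uniq.
have sc : 0 < size c by case: (c) c0.
apply: (@e_sub delta x c.[0]); first by rewrite /delta (negPf xc).
  by rewrite deltaE //; have [] := cw 0 sc.
move=> k; rewrite {1}/delta; case: ifP => // kc _.
have kE : k = c.[index k c] by rewrite nth_index.
move: kE; set a := index k c => ->; have ac : a < size c by rewrite index_mem.
have [_ nu nw /allP na] := cw a ac; rewrite deltaE //; apply: leq_trans nw _.
have nbE : \sum_(b <- nb a) w b = \sum_(v <- [seq c.[b] | b <- nb a]) delta v.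
  by rewrite big_map !big_seq; apply: eq_bigr => b /na/andP[bc _]; rewrite deltaE.
rewrite nbE big_uniq /=; last first.
  rewrite map_inj_in_uniq // => b b' /na/andP[bc _] /na/andP[bc' _] /eqP.
  by rewrite nth_uniq // => /eqP.
rewrite [leqRHS](bigID (mem [seq c.[b] | b <- nb a])) /=.
apply: leq_trans (leq_addr _ _); apply: leq_sum => v /mapP[b /na/andP[_ ab] ->].
by rewrite leq_pmull.
Qed.

(** A double edge carries the weights 1, 1, and [n_ge3] supplies a vertex outside it. *)
Lemma e_le1 i j : e i j <= 1.
Proof.
rewrite leqNgt; apply/negP => ij2.
have ij : i != j by apply: contraTneq ij2 => ->; rewrite e0.
have [x [xi xj]] : exists x : 'I_n, x != i /\ x != j.
  have : 0 < #|~: [set i; j]| by rewrite cardsC1 || (have := cardsC [set i; j]; rewrite card_ord cards2; lia).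
  by case/card_gt0P => x; rewrite !inE negb_or => /andP[]; exists x.
pose delta v : nat := (v == i) || (v == j).
apply: (@e_sub delta x i); rewrite /delta ?eqxx ?(negPf xi) ?(negPf xj) //.
move=> k; case: (eqVneq k i) => [-> _|ki /=].
  by rewrite (negPf ij) (bigD1 j) //= eqxx orbT; lia.
case: (eqVneq k j) => // -> _.
by rewrite (bigD1 i) //= eqxx eC; lia.
Qed.

Lemma e_adj i j : adj i j -> e i j = 1.
Proof. by move=> /= ij; apply/eqP; rewrite eqn_leq e_le1. Qed.

Definition matches (c : seq 'I_n) es :=
  forall a b, a <= b < size c -> e c.[a] c.[b] = diagram_mult es a b.

Lemma matches_perm c es : uniq c -> (forall x, x \in c) -> matches c es ->
  size c = n /\ exists s : {perm 'I_n}, forall i j : 'I_n,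
    e i j = diagram_mult es (s i) (s j).
Proof.
move=> cu cf cm.
have sc : size c = n.
  by rewrite -[RHS]card_ord -(card_uniqP cu); apply: eq_card => x; rewrite cf.
split=> //.
have lt i : index i c < n by have := cf i; rewrite -index_mem sc.
pose f i := Ordinal (lt i).
have fi : injective f.
  by move=> i j [] /(congr1 (nth x0 c)); rewrite !nth_index.
exists (perm fi) => i j; rewrite !permE /=.
wlog ij : i j / index i c <= index j c.
  move=> H; case: (leqP (index i c) (index j c)) => h; first exact: H.
  by rewrite eC diagram_multC; apply: H; apply: ltnW.
by rewrite -cm ?ij ?index_mem ?cf // !nth_index.
Qed.

Lemma cycle_full c : uniq c -> 3 <= size c -> cycle adj c -> forall x, x \in c.
Proof.
move=> cu c3 cc; apply: (@weights_full c (fun=> 1)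
  (fun a => [:: if a == (size c).-1 then 0 else a.+1; if a == 0 then (size c).-1 else a.-1])) => //.
  by case: (c) c3.
have next a : a < size c -> adj c.[a] c.[if a == (size c).-1 then 0 else a.+1].
  case: c cu c3 cc => // y c _ _ /= /(pathP x0) cP.
  rewrite ltnS leq_eqVlt => /predU1P[->|ac]; rewrite ?eqxx.
    by have := cP (size c); rewrite size_rcons nth_rcons ltnn eqxx -rcons_cons nth_rcons /= ltnSn => ->.
  by have := cP a; rewrite (ltn_eqF ac) size_rcons nth_rcons ac -rcons_cons nth_rcons /= ltnS ltnW // => ->.
move=> a ac; split=> //; first by rewrite /= inE; do 2! case: ifP; lia.
  by rewrite /= !big_cons big_nil.
apply/allP => b; rewrite !inE => /orP[]/eqP->; apply/andP; split.
- by case: ifP; lia.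
- exact: next.
- by case: ifP; lia.
rewrite /= eC; set b' := if a == 0 then _ else _.
have -> : a = if b' == (size c).-1 then 0 else b'.+1.
  by rewrite /b'; do 2! case: ifP; lia.
by apply: next; rewrite /b'; case: ifP; lia.
Qed.

Lemma sorted_cycle c : sorted adj c -> adj c.[0] c.[(size c).-1] -> cycle adj c.
Proof.
case: c => //= y c cs; rewrite rcons_path cs /= (last_nth x0) eC.
by case: c {cs}.
Qed.

Lemma arc_cycle s a b : uniq s -> sorted adj s -> a.+1 < b < size s ->
  adj s.[a] s.[b] ->
  exists c, [/\ uniq c, cycle adj c, 3 <= size c & size c = (b - a).+1].
Proof.
move=> su ss /andP[ab bs] sab; exists (drop a (take b.+1 s)).
have sz : size (drop a (take b.+1 s)) = (b - a).+1.
  by rewrite size_drop size_takel //; lia.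
split; rewrite ?sz //; last by lia.
  by rewrite drop_uniq // take_uniq.
apply: sorted_cycle; first by rewrite drop_sorted // take_sorted.
by rewrite sz !nth_drop !nth_take ?addn0 ?subnKC //=; lia.
Qed.

(** A chord cuts off a shorter cycle, which by [cycle_full] still contains all [n] vertices; its
    length then shows that the chord is the closing edge. *)
Lemma cycle_matches c : uniq c -> 3 <= size c -> cycle adj c ->
  matches c (chain n ++ [:: (n.-1, 0)]).
Proof.
move=> cu c3 cc; have cf := cycle_full cu c3 cc.
have sc : size c = n.
  by rewrite -[RHS]card_ord -(card_uniqP cu); apply: eq_card => x; rewrite cf.
have cs : sorted adj c by case: (c) cc => //= y t; rewrite rcons_path => /andP[].
have cl : adj c.[0] c.[(size c).-1].
  case: (c) c3 cc => // y t _; rewrite /= rcons_path (last_nth x0) => /andP[_].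
  by rewrite /= eC.
rewrite sc in cl.
move=> a b /andP[ab bc]; rewrite diagram_mult_cat diagram_mult_chain // /diagram_mult /= !xpair_eqE.
move: ab; rewrite leq_eqVlt => /predU1P[<-|ab]; first by rewrite e0; lia.
move: ab; rewrite leq_eqVlt => /predU1P[E|ab].
  rewrite -E in bc *; rewrite e_adj; first by lia.
  by move/(sortedP x0): cs; apply.
case: (posnP (e c.[a] c.[b])) => eab.
  rewrite eab; case: (boolP ((a == 0) && (b == n.-1))); last by lia.
  by case/andP=> /eqP a0 /eqP bn; move: cl; rewrite -a0 -bn /= eab.
have [d [du dc d3 ds]] := arc_cycle cu cs (introT andP (conj ab bc)) eab.
rewrite e_adj //; suff: size d = n by lia.
rewrite -[RHS]card_ord -(card_uniqP du); apply: eq_card => x.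
by rewrite (cycle_full du d3 dc).
Qed.

(** * Trees, read off from a longest path *)

Section Tree.
Hypothesis tree : forall c, uniq c -> 3 <= size c -> ~~ cycle adj c.

Lemma path_matches s a b : uniq s -> sorted adj s -> a <= b < size s ->
  e s.[a] s.[b] = (b == a.+1).
Proof.
move=> su ss /andP[]; rewrite leq_eqVlt => /predU1P[->|]; first by rewrite e0; lia.
rewrite leq_eqVlt => /predU1P[<- bs|ab bs].
  by rewrite e_adj ?eqxx //; move/(sortedP x0): ss; apply.
have -> : (b == a.+1) = false by lia.
apply/eqP; rewrite eqn0Ngt; apply/negP => eab.
have [d [du dc d3 _]] := arc_cycle su ss (introT andP (conj ab bs)) eab.
by have := tree du d3; rewrite dc.
Qed.

Lemma sorted_cons y s : sorted adj s -> adj y s.[0] -> sorted adj (y :: s).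
Proof. by case: s => //= z s -> ->. Qed.

Lemma sorted_rcons y s : sorted adj s -> adj s.[(size s).-1] y -> sorted adj (rcons s y).
Proof. by case: s => //= z s ss; rewrite rcons_path ss (last_nth x0). Qed.

(** Placing [y] before the part of [q] that starts at [t], or after the part that ends there, gives
    a path, and a path in a tree has no chords. *)
Lemma branch_edge q y t b : uniq (y :: q) -> sorted adj q -> t < size q ->
  adj y q.[t] -> b < size q -> e q.[b] y = (b == t).
Proof.
move=> /= /andP[yq qu] qs tq yt bq; case: (leqP t b) => tb.
  have := @path_matches (y :: drop t q) 0 (b - t).+1.
  rewrite /= nth_drop subnKC // size_drop eC => ->; first by lia.
  - by rewrite drop_uniq // andbT; apply: contra yq; apply: mem_drop.
  - apply: sorted_cons; first exact: drop_sorted.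
    by rewrite nth_drop addn0.
  - by lia.
have := @path_matches (rcons (take t.+1 q) y) b t.+1.
rewrite !nth_rcons size_takel // ltnn eqxx ltnS (ltnW tb) nth_take; last by lia.
rewrite size_rcons size_takel // => ->; first by lia.
- by rewrite rcons_uniq take_uniq // andbT; apply: contra yq; apply: mem_take.
- apply: sorted_rcons; first exact: take_sorted.
  by rewrite size_takel //= nth_take //= eC.
- by lia.
Qed.

Lemma branch_matches q y t : uniq (y :: q) -> sorted adj q -> t < size q ->
  adj y q.[t] -> matches (rcons q y) (chain (size q) ++ [:: (t, size q)]).
Proof.
move=> qyu qs tq yt a b; rewrite size_rcons ltnS => /andP[ab bq].
rewrite diagram_mult_cat diagram_mult_chain // /diagram_mult /= !xpair_eqE !nth_rcons.
move: bq ab; rewrite leq_eqVlt => /predU1P[->|bq] ab; last first.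
  rewrite bq (leq_ltn_trans ab bq) path_matches ?ab //; first by lia.
  by case/andP: qyu.
rewrite ltnn eqxx; case: (ltnP a (size q)) => aq; first by rewrite (branch_edge qyu qs tq) //; lia.
have -> : a == size q by lia.
by rewrite e0; lia.
Qed.

Lemma matches_adj c es a b : matches c es -> a < size c -> b < size c ->
  adj c.[a] c.[b] = (0 < diagram_mult es a b).
Proof.
move=> cm ac bc /=; case: (leqP a b) => ab; first by rewrite cm ?ab.
by rewrite eC diagram_multC cm // (ltnW ab).
Qed.

(** Boolean subadditivity, so that explicit weights on the extended E diagrams are checked by
    evaluation. *)
Definition check_weights es (ws : seq nat) :=
  let m := size ws in
  all (fun a => (0 < nth 0 ws a) && (2 * nth 0 ws a <=
    sumn [seq nth 0 ws b | b <- iota 0 m & 0 < diagram_mult es a b])) (iota 0 m).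

Lemma matches_full c es ws : uniq c -> matches c es -> size c = size ws ->
  ws != [::] -> check_weights es ws -> forall x, x \in c.
Proof.
move=> cu cm cw ws0 /allP cws.
apply: (weights_full (w := nth 0 ws)
  (nb := fun a => [seq b <- iota 0 (size ws) | 0 < diagram_mult es a b])) => //.
  by rewrite -size_eq0 cw size_eq0.
move=> a ac; have /cws/andP[wa sa] : a \in iota 0 (size ws) by rewrite mem_iota -cw.
split=> //; first by rewrite filter_uniq ?iota_uniq.
  by rewrite sumnE big_map in sa.
apply/allP => b; rewrite mem_filter mem_iota /= -cw => /andP[eb bc].
by have /= -> := matches_adj cm ac bc; rewrite bc eb.
Qed.

(** The vertices [y] and [z] are not joined, since [y], the inner vertices of [q] and [z] form a
    path. The graph is then of extended type D, and its additive function forces it to contain every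
    vertex. *)
Lemma double_branch q y z : 3 <= size q -> uniq (y :: z :: q) -> sorted adj q ->
  adj y q.[1] -> adj z q.[size q - 2] ->
  (forall x, x \in q ++ [:: y; z]) /\
  matches (q ++ [:: y; z])
    (chain (size q) ++ [:: (1, size q); (size q - 2, (size q).+1)]).
Proof.
set L := size q => L3 u qs yq zq.
have qu : uniq q by case/and3P: u.
have yqu : uniq (y :: q) by move: u; rewrite /= inE negb_or => /and3P[/andP[_ ->]].
have zqu : uniq (z :: q) by case/andP: u.
have yz : e y z = 0.
  pose d := drop 1 (take (L - 1) q).
  have sz : size d = L - 2 by rewrite size_drop size_takel; lia.
  have dq x : x \in d -> x \in q by move=> /mem_drop/mem_take.
  have := @path_matches (y :: rcons d z) 0 (L - 2).+1.
  rewrite /= nth_rcons sz ltnn eqxx size_rcons sz => -> //; first by lia.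
  - rewrite mem_rcons inE negb_or rcons_uniq drop_uniq ?take_uniq //= andbT.
    move: u; rewrite /= inE negb_or => /and3P[/andP[-> yq'] zq' _] /=.
    by apply/andP; split; [apply: contra yq'|apply: contra zq'] => /dq.
  - apply: (@sorted_cons y (rcons d z)); last first.
      by rewrite nth_rcons sz ifT ?nth_drop ?nth_take //; lia.
    apply: sorted_rcons; first by rewrite drop_sorted ?take_sorted.
    rewrite sz nth_drop nth_take; last by lia.
    have -> : 1 + (L - 2).-1 = L - 2 by lia.
    by rewrite /= eC.
have m : matches (q ++ [:: y; z]) (chain L ++ [:: (1, L); (L - 2, L.+1)]).
  move=> a b; rewrite size_cat /= addn2 -/L => /andP[ab bL].
  rewrite diagram_mult_cat diagram_mult_chain // /diagram_mult /= !xpair_eqE !nth_cat -/L.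
  case: (ltnP b L) => bL'; first by rewrite (leq_ltn_trans ab bL') path_matches ?ab //; lia.
  case: (ltnP a L) => aL.
    case: (eqVneq b L) => [->|bL2].
      by rewrite subnn /= (branch_edge yqu qs _ yq) //; lia.
    have -> : b = L.+1 by lia.
    by rewrite subSnn /= (branch_edge zqu qs _ zq) //; lia.
  have : [\/ a = L /\ b = L, a = L /\ b = L.+1 | a = L.+1 /\ b = L.+1].
    by case: (eqVneq a L) => [aE|aL']; case: (eqVneq b L) => [bE|bL2];
      [apply: Or31|apply: Or32|exfalso|apply: Or33]; lia.
  by case=> -[-> ->]; rewrite ?subnn ?subSnn /= ?e0 ?yz; lia.
split=> //; apply: (@weights_full _ (forked_weight L) (forked_neighbours L)).
- by rewrite cat_uniq qu /= !inE !negb_or; case/and3P: u; rewrite inE negb_or => /andP[-> ->] ->.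
- by case: (q).
move=> a; rewrite size_cat /= addn2 -/L => aL.
have [w0 wu wS /allP wA] := forked_weights L3 aL; split=> //.
apply/allP => b /wA/andP[bL ab]; rewrite bL /=.
by have /= -> := matches_adj (a := a) (b := b) m; rewrite ?size_cat /= ?addn2.
Qed.

Lemma longest_path : exists p,
  [/\ uniq p, sorted adj p, p != [::] &
      forall s, uniq s -> sorted adj s -> size s <= size p].
Proof.
pose P k := [exists t : k.-tuple 'I_n, uniq t && sorted adj t].
have P1 : exists k, P k by exists 1; apply/existsP; exists [tuple x0].
have Pn k : P k -> k <= n.
  by case/existsP=> t /andP[tu _]; rewrite -(size_tuple t) -(card_uniqP tu) -[leqRHS](card_ord n) max_card.
case: (ex_maxnP P1 Pn) => N /existsP[t /andP[tu ts]] Nmax.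
have Pmax s : uniq s -> sorted adj s -> size s <= N.
  by move=> su ss; apply: Nmax; apply/existsP; exists (in_tuple s); rewrite su ss.
exists t; split=> // [|s]; last by rewrite size_tuple; apply: Pmax.
by rewrite -size_eq0 size_tuple -lt0n; apply: (Pmax [:: x0]).
Qed.

Definition classified :=
  exists es c, [/\ dynkin_diagram n es \/ extended_dynkin_diagram n es,
    uniq c, (forall x, x \in c) & matches c es].

Lemma size_full c : uniq c -> (forall x, x \in c) -> size c = n.
Proof.
by move=> cu cf; rewrite -[RHS]card_ord -(card_uniqP cu); apply: eq_card => x; rewrite cf.
Qed.

Lemma closed_full c : c != [::] -> (forall u v, u \in c -> adj u v -> v \in c) ->
  forall x, x \in c.
Proof.
case: c => // u c _ ch x.
have cl : closed adj (mem (u :: c)).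
  by move=> a b ab; apply/idP/idP => [/ch|/ch]; apply=> //; rewrite /= eC.
by rewrite -(closed_connect cl (e_conn u x)) mem_head.
Qed.

Section Branch.
Variables (p : seq 'I_n) (y : 'I_n) (i : nat).
Hypothesis pu : uniq p.
Hypothesis ps : sorted adj p.
Hypothesis p_max : forall s, uniq s -> sorted adj s -> size s <= size p.
Hypothesis yp : y \notin p.
Hypothesis ip : i < size p.
Hypothesis yi : adj y p.[i].

(** At an end of [p], the vertex [y] would extend the longest path. *)
Lemma branch_inner : 0 < i /\ i.+1 < size p.
Proof.
split; rewrite ltnNge; apply/negP => h.
  suff : size (y :: p) <= size p by rewrite /= ltnn.
  apply: p_max; first by rewrite /= yp.
  by apply: sorted_cons => //; move: yi; have -> : i = 0 by lia.
suff : size (rcons p y) <= size p by rewrite size_rcons ltnn.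
apply: p_max; first by rewrite rcons_uniq yp.
by apply: sorted_rcons => //; rewrite /= eC; have <- : i = (size p).-1 by lia.
Qed.

Lemma two_branches z j : z \notin p -> z != y -> i <= j < size p ->
  adj z p.[j] -> j.+1 < size p -> classified.
Proof.
move=> zp zy /andP[ij jp] zj jp1; have [i0 ip1] := branch_inner.
(* The segment of [p] from position i - 1 to position j + 1, with [y] and [z] attached next to its
   ends. *)
pose q := take (j - i + 3) (drop i.-1 p).
have qs : size q = j - i + 3 by rewrite size_takel // size_drop; lia.
have qE a : a < size q -> q.[a] = p.[i.-1 + a].
  by rewrite qs => aq; rewrite nth_take // nth_drop.
have qp x : x \in q -> x \in p by move/mem_take/mem_drop.
have qu : uniq [:: y, z & q].
  rewrite /= inE eq_sym negb_or zy take_uniq ?drop_uniq // andbT /=.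
  by apply/andP; split; [apply: contra yp|apply: contra zp] => /qp.
have [] := @double_branch q y z _ qu.
- by rewrite qs; lia.
- by rewrite take_sorted // drop_sorted.
- by rewrite qE ?qs; [have -> : i.-1 + 1 = i by lia|lia].
- by rewrite qE ?qs; [have -> : i.-1 + (j - i + 3 - 2) = j by lia|lia].
move=> cf cm; have cu : uniq (q ++ [:: y; z]) by rewrite uniq_catC.
have := size_full cu cf; rewrite size_cat /= addn2 => nE.
do 2!eexists; split; last exact: cm; [right|by []|by []].
have := @ExtDynkin_D (size q).+1; rewrite /= !subSS subn0 nE; apply.
by rewrite qs; lia.
Qed.

Hypothesis y_only : forall z u, z \notin p -> u \in p -> adj z u -> z = y.
Hypothesis ip2 : i.*2 < size p.

Lemma sub_branch a m t : a + m <= size p -> a + t = i -> t < m ->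
  let q := take m (drop a p) in
  [/\ size q = m, uniq (y :: q) & matches (rcons q y) (chain m ++ [:: (t, m)])].
Proof.
move=> ap at_ tm q.
have qs : size q = m by rewrite size_takel // size_drop; lia.
have qu : uniq (y :: q).
  by rewrite /= take_uniq ?drop_uniq // andbT; apply: contra yp => /mem_take/mem_drop.
split=> //; have := @branch_matches q y t qu; rewrite qs; apply=> //.
  by rewrite take_sorted // drop_sorted.
by rewrite nth_take // nth_drop at_.
Qed.

(** Replacing the first arm of [p] by the arm through [y] and [z] cannot lengthen [p], so this arm
    has at least two vertices, and by [ip2] so has the other. Three arms of length 2 form extended
    E6. *)
Lemma long_branch z : z \notin p -> adj y z -> classified.
Proof.
move=> zp yz; have [i0 ip1] := branch_inner.
have zy : z != y by apply: contraTneq yz => ->; rewrite /= e0.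
have i2 : 1 < i.
  have := p_max (s := [:: z, y & drop i p]).
  rewrite /= inE negb_or zy drop_uniq // andbT size_drop => h.
  suff : (size p - i).+2 <= size p by clear -i0; lia.
  apply: h.
    by apply/andP; split; [apply: contra zp|apply: contra yp] => /mem_drop.
  rewrite eC; have /= -> := yz; apply: (@sorted_cons y (drop i p)).
    exact: drop_sorted.
  by rewrite nth_drop addn0.
have [|||qs qu qm] := @sub_branch (i - 2) 5 2; try lia.
set q := take 5 _ in qs qu qm.
have cm : matches (rcons (rcons q y) z) (chain 5 ++ [:: (2, 5); (5, 6)]).
  move=> a b; rewrite size_rcons ltnS => /andP[ab].
  have sE : size (rcons q y) = 6 by rewrite size_rcons qs.
  rewrite leq_eqVlt => /predU1P[bE|bq]; last first.
    have aq := leq_ltn_trans ab bq.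
    rewrite !(nth_rcons _ (rcons q y)) aq bq qm ?ab //.
    rewrite -[RHS]/(diagram_mult ((chain 5 ++ [:: (2, 5)]) ++ [:: (5, 6)]) a b).
    rewrite [RHS]diagram_mult_cat -[LHS]addn0; congr (_ + _).
    move: bq aq; rewrite sE => b6 a6; rewrite /diagram_mult /= !xpair_eqE.
    by clear -b6 a6; lia.
  have -> : (rcons (rcons q y) z).[b] = z by rewrite nth_rcons bE ltnn eqxx.
  rewrite bE sE in ab *.
  move: ab; rewrite leq_eqVlt => /predU1P[->|].
    by rewrite nth_rcons sE ltnn eqxx e0.
  rewrite ltnS leq_eqVlt => /predU1P[->|a5].
    by rewrite nth_rcons sE /= nth_rcons qs ltnn eqxx e_adj.
  rewrite nth_rcons sE ltnW // nth_rcons qs a5.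
  have -> : diagram_mult (chain 5 ++ [:: (2, 5); (5, 6)]) a 6 = 0.
    by case: a a5 => [|[|[|[|[|a]]]]].
  apply/eqP; rewrite eqn0Ngt; apply/negP => h.
  have qp : q.[a] \in p by apply/mem_drop/mem_take/mem_nth; rewrite qs.
  by move: zy; rewrite (y_only zp qp) ?eqxx //= eC.
have cu : uniq (rcons (rcons q y) z).
  rewrite !rcons_uniq mem_rcons inE negb_or zy -andbA; move: qu => /= /andP[-> ->].
  by rewrite !andbT; apply: contra zp => /mem_take/mem_drop.
have cs : size (rcons (rcons q y) z) = 7 by rewrite !size_rcons qs.
have cf := @matches_full _ _ [:: 1; 2; 3; 2; 1; 2; 1] cu cm cs isT isT.
do 2!eexists; split; last exact: cm; [right|by []|by []].
by rewrite -(size_full cu cf) cs; constructor.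
Qed.

(** Here [p] and [y] are the whole graph, with arms of lengths 1, i and size p - 1 - i, of which i
    is at most the last. If i >= 3 there is an extended E7. If i = 1 the type is D. If i = 2 the
    last arm gives E6, E7, E8, or contains extended E8 when it has at least 5 vertices. *)
Lemma short_branch : (forall z, z \notin p -> ~~ adj y z) -> classified.
Proof.
move=> yz; have [i0 ip1] := branch_inner.
have pf : forall x, x \in rcons p y.
  apply: closed_full => [|u v]; first by case: (p).
  rewrite !mem_rcons !inE => /predU1P[->|up] uv.
    by apply/orP; right; apply: contraTT uv; apply: yz.
  case: (boolP (v \in p)) => vp; first by rewrite orbT.
  by rewrite (y_only vp up) ?eqxx //= eC.
have rcu q : uniq (y :: q) -> uniq (rcons q y) by rewrite rcons_uniq.
have pyu : uniq (rcons p y) by rewrite rcons_uniq yp.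
have := size_full pyu pf; rewrite size_rcons => nE.
case: (ltnP 2 i) => [i3|i2].
  have [|||qs qu qm] := @sub_branch (i - 3) 7 3; try lia.
  set q := take 7 _ in qs qu qm; have cs : size (rcons q y) = 8 by rewrite size_rcons qs.
  have cf := @matches_full _ _ [:: 1; 2; 3; 4; 3; 2; 1; 2] (rcu _ qu) qm cs isT isT.
  do 2!eexists; split; last exact: qm; [right|exact: rcu|by []].
  by rewrite -(size_full (rcu _ qu) cf) cs; constructor.
case: (ltnP 1 i) => [i2'|i1]; last first.
  (* The path is reversed because the diagram D is forked at the far end of its chain. *)
  have pR : sorted adj (rev p).
    by rewrite rev_sorted; apply: sub_sorted ps => a b /=; rewrite eC.
  have ryu : uniq (y :: rev p) by rewrite /= mem_rev yp rev_uniq.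
  have := @branch_matches (rev p) y (size p - 2) ryu pR.
  rewrite size_rev nth_rev; last by lia.
  have -> : size p - (size p - 2).+1 = i by lia.
  move=> cm; do 2!eexists; split; last (apply: cm => //; lia).
  - by left; have := @Dynkin_D (size p).+1; rewrite /= !subSS subn0 nE; apply; lia.
  - exact: rcu.
  - by move=> x; have := pf x; rewrite !mem_rcons !inE mem_rev.
have iE : i = 2 by lia.
case: (ltnP 7 (size p)) => p8.
  have [|||qs qu qm] := @sub_branch 0 8 2; try lia.
  set q := take 8 _ in qs qu qm; have cs : size (rcons q y) = 9 by rewrite size_rcons qs.
  have cf := @matches_full _ _ [:: 2; 4; 6; 5; 4; 3; 2; 1; 3] (rcu _ qu) qm cs isT isT.
  do 2!eexists; split; last exact: qm; [right|exact: rcu|by []].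
  by rewrite -(size_full (rcu _ qu) cf) cs; constructor.
have [|||_ _] := @sub_branch 0 (size p) 2; try lia.
rewrite drop0 take_size => cm.
do 2!eexists; split; last exact: cm; [left|by []|by []].
have : size p = 5 \/ size p = 6 \/ size p = 7 by lia.
by case=> [|[]] pE; move: nE; rewrite pE => <-; constructor.
Qed.

End Branch.

(** If nothing is attached to a longest path, the type is A; two distinct vertices attached to it
    give extended D; a single one leaves the cases of [long_branch] and [short_branch]. *)
Lemma tree_classified : classified.
Proof.
have [p [pu ps p0 pmax]] := longest_path.
case: (boolP (has (fun y => (y \notin p) && has (adj y) p) (enum 'I_n))); last first.
  move=> /hasPn h.
  have pf : forall x, x \in p.
    apply: closed_full => // u v up uv; apply/negPn/negP => vp.
    have := h v; rewrite mem_enum vp => /(_ isT)/hasPn/(_ u up) /=.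
    by rewrite eC; move: uv => /= ->.
  exists (chain n), p; split=> //; first by left; constructor; lia.
  move=> a b /andP[ab bp]; rewrite path_matches ?ab // diagram_mult_chain //.
  by rewrite -(size_full pu pf) bp andbT.
case/hasP=> y _ /andP[yp /hasP[u up yu]].
have {up yu} [i ip yi] : exists2 i, i < size p & adj y p.[i].
  by exists (index u p); rewrite ?index_mem ?nth_index.
case: (boolP (has (fun z => [&& z \notin p, z != y & has (adj z) p]) (enum 'I_n))).
  case/hasP=> z _ /and3P[zp zy /hasP[v vp zv]].
  have {vp zv} [j jp zj] : exists2 j, j < size p & adj z p.[j].
    by exists (index v p); rewrite ?index_mem ?nth_index.
  have [_ ip1] := branch_inner pu ps pmax yp ip yi.
  have [_ jp1] := branch_inner pu ps pmax zp jp zj.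
  case: (leqP i j) => ij; first by apply: (two_branches pu ps pmax yp ip yi zp zy _ zj jp1); rewrite ij.
  apply: (two_branches pu ps pmax zp jp zj yp _ _ yi ip1); first by rewrite eq_sym.
  by rewrite ltnW.
move=> /hasPn h.
have yo : forall z u, z \notin p -> u \in p -> adj z u -> z = y.
  move=> z v zp vp zv; apply/eqP; apply: contraTT isT => zy.
  have := h z; rewrite mem_enum zp zy => /(_ isT)/hasPn/(_ v vp); by rewrite zv.
(* Reversing [p] if necessary, the branch point lies no farther from the start than from the end. *)
wlog ip2 : p i {u p0 h} pu ps pmax yp ip yi yo / i.*2 < size p.
  move=> H; case: (ltnP i.*2 (size p)) => hi; first exact: (H p i).
  apply: (H (rev p) (size p - i.+1)); rewrite ?rev_uniq ?size_rev ?mem_rev //.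
  - by rewrite rev_sorted; apply: sub_sorted ps => a b /=; rewrite eC.
  - by lia.
  - by rewrite nth_rev ?subnSK ?subKn ?(ltnW ip) ?leq_subr.
  - by move=> z v; rewrite !mem_rev; apply: yo.
  - by lia.
case: (boolP (has (fun z => (z \notin p) && adj y z) (enum 'I_n))).
  case/hasP=> z _ /andP[zp yz].
  exact: (long_branch pu ps pmax yp ip yi yo ip2 zp yz).
move=> /hasPn h; apply: (short_branch pu ps pmax yp ip yi yo ip2) => z zp.
by have := h z; rewrite mem_enum zp => /(_ isT).
Qed.

End Tree.

Lemma graph_classified : exists2 es,
  dynkin_diagram n es \/ extended_dynkin_diagram n es &
  exists s : {perm 'I_n}, forall i j : 'I_n, e i j = diagram_mult es (s i) (s j).
Proof.
suff [es [c [h cu cf cm]]] : classified.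
  by exists es => //; have [] := matches_perm cu cf cm.
pose has_cycle := [exists k : 'I_n.+1, exists t : k.-tuple 'I_n,
  [&& uniq t, 3 <= size t & cycle adj t]].
case: (boolP has_cycle) => [/existsP[k /existsP[c /and3P[cu c3 cc]]]|nc].
  have cf := cycle_full cu c3 cc.
  do 2!eexists; split; last exact: (cycle_matches cu c3 cc); [right|by []|by []].
  by have := @ExtDynkin_A n.-1; rewrite prednK; [apply; lia|lia].
apply: tree_classified => c cu c3; apply/negP => cc; case/negP: nc.
have cn : size c < n.+1 by rewrite ltnS -(card_uniqP cu) -[leqRHS](card_ord n) max_card.
by apply/existsP; exists (Ordinal cn); apply/existsP; exists (in_tuple c); rewrite cu cc c3.
Qed.

End Graph.

(** * Certificates for the exceptional diagrams *)

(* The computations below are repeated by the kernel, hence the use of bare   *)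
(* sequences and of the operations underlying the algebraic structures.       *)
Definition imat := seq (seq int).

Definition entry (M : imat) (i j : nat) : int := nth (Posz 0) (nth [::] M i) j.

(** The new entry at (i, j) for a = b_ik, c = b_kj and b = b_ij: only factors of the same sign
    contribute, by plus or minus the product of their absolute values. *)
Definition mut_entry (a c b : int) : int :=
  match a, c with
  | Posz a', Posz c' => intZmod.addz b (Posz (a' * c'))
  | Negz a', Negz c' => intZmod.addz b (intZmod.oppz (Posz (a'.+1 * c'.+1)))
  | _, _ => b
  end.

Definition imut (n k : nat) (M : imat) : imat :=
  let rk := nth [::] M k in
  mkseq (fun i => let r := nth [::] M i in let a := nth (Posz 0) r k in
    mkseq (fun j => let b := nth (Posz 0) r j in
      if eqn i k || eqn j k then intZmod.oppz b
      else mut_entry a (nth (Posz 0) rk j) b) n) n.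

Definition iperm (o : seq nat) (M : imat) : imat :=
  [seq [seq nth (Posz 0) r j | j <- o] | r <- [seq nth [::] M i | i <- o]].

Definition iopp (M : imat) : imat := map (map intZmod.oppz) M.

Definition inteq (a b : int) : bool :=
  match a, b with Posz x, Posz y | Negz x, Negz y => eqn x y | _, _ => false end.

(* [(i, e, o)] tells that reindexing by [o] turns a matrix into the [i]-th    *)
(* matrix of the list, up to a sign [e].                                      *)
Definition link := (positive * bool * seq nat)%type.

(* The matrices, each with its links for the mutations at 0, ..., n - 1, and   *)
(* then the links of all orientations of the diagram.                         *)
Definition certificate := (seq (imat * seq link) * seq link)%type.

(* Enumeration up to a normal form obtained by colour refinement.  It is an   *)
(* unverified search: the normal form need not be canonical, and its output   *)
(* is checked by [valid].                                                     *)
Section Generate.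
Local Open Scope N_scope.

(** The masks are arbitrary bit patterns serving as a hash; correctness does not depend on them. *)
Definition weight (x : int) (c : N) : N :=
  match x with
  | Posz 0 => 0
  | Posz 1 => N.lxor c 819
  | Posz _ => N.lxor c 3276
  | Negz 0 => N.lxor c 2730
  | Negz _ => N.lxor c 1365
  end.

Definition refine (M : imat) (cs : seq N) : seq N :=
  [seq N.land (p.2 * 5 + foldr N.add 0 [seq weight q.1 q.2 | q <- zip p.1 cs]) 4095
  | p <- zip M cs].

Fixpoint tie (s : seq (N * nat)) : option nat :=
  if s is (c, i) :: (((d, _) :: _) as s') then
    if N.eqb c d then Some i else tie s'
  else None.

(** If two vertices keep the same colour, one of them is recoloured and the refinement is
    repeated. *)
Fixpoint split_ties (fuel : nat) (M : imat) (cs : seq N) : seq nat :=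
  let s := sort (fun p q : N * nat => N.leb p.1 q.1) (zip cs (iota 0 (size cs))) in
  if (fuel, tie s) is (f.+1, Some i) then
    split_ties f M (refine M (refine M (set_nth 0 cs i (N.land (nth 0 cs i + 777) 4095))))
  else map snd s.

Definition order (M : imat) : seq nat :=
  split_ties 20 M (iter 3 (refine M) (nseq (size M) 1)).

Definition code (M : imat) : positive :=
  foldl (fun p x => match x with Posz 0 => p~0~0~0 | Posz 1 => p~0~0~1
     | Posz _ => p~0~1~0 | Negz 0 => p~0~1~1 | Negz _ => p~1~0~0 end)%positive
  1%positive (flatten M).

Definition nform (M : imat) : imat * positive * bool * seq nat :=
  let o := order M in let o' := order (iopp M) in
  let M1 := iperm o M in let M2 := iperm o' (iopp M) in
  let c1 := code M1 in let c2 := code M2 in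
  if Pos.leb c1 c2 then (M1, c1, false, o) else (M2, c2, true, o').

(* Indices of the known codes, next index, matrices to be explored.           *)
Definition state := (PositiveMap.t positive * positive * seq imat)%type.

Definition visit (st : state) (M : imat) : state * link :=
  let: (ids, nxt, todo) := st in
  let: (T, c, e, o) := nform M in
  if PositiveMap.find c ids is Some i then (st, (i, e, o))
  else ((PositiveMap.add c nxt ids, Pos.succ nxt, T :: todo), (nxt, e, o)).

Fixpoint visits (st : state) (Ms : seq imat) : state * seq link :=
  if Ms is M :: Ms' then
    let: (st1, l) := visit st M in let: (st2, ls) := visits st1 Ms' in (st2, l :: ls)
  else (st, [::]).

(** Breadth first, in the order of the indices: after the final [rev] the positions in the list,
    counted from 1, are the indices used by the links. *)
Fixpoint explore (fuel n : nat) (queue : seq imat) (st : state) (acc : seq (imat * seq link)) :=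
  if fuel is f.+1 then
    match queue with
    | M :: q => let: (st', ls) := visits st [seq imut n k M | k <- iota 0 n] in
                explore f n q st' ((M, ls) :: acc)
    | [::] => let: (ids, nxt, todo) := st in
              if todo is [::] then (acc, st) else explore f n (rev todo) (ids, nxt, [::]) acc
    end
  else (acc, st).
End Generate.

(** * Initial orientations, and the checker for certificates *)

Definition oriented (n : nat) (ps : seq (nat * nat)) : imat :=
  mkseq (fun i => mkseq (fun j => if (i, j) \in ps then Posz 1
                            else if (j, i) \in ps then Negz 0 else Posz 0) n) n.

Fixpoint orientations (es : seq (nat * nat)) : seq (seq (nat * nat)) :=
  if es is (a, b) :: es' then
    let r := orientations es' in map (cons (a, b)) r ++ map (cons (b, a)) r
  else [:: [::]].

Definition generate (n : nat) (es : seq (nat * nat)) : certificate :=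
  let: (st, starts) := visits (PositiveMap.empty _, 1%positive, [::])
                              [seq oriented n ps | ps <- orientations es] in
  (rev (explore (100 * 100) n [::] st [::]).1, starts).

Definition table (l : seq (imat * seq link)) : PositiveMap.t imat :=
  (foldl (fun (p : positive * PositiveMap.t imat) c =>
     (Pos.succ p.1, PositiveMap.add p.1 c.1 p.2)) (1%positive, PositiveMap.empty _) l).2.

Fixpoint upper_eq (i : nat) (M T : imat) : bool :=
  match M, T with
  | r :: M', r' :: T' => all2 inteq (drop i r) (drop i r') && upper_eq i.+1 M' T'
  | _, _ => true
  end.

Definition iskew (n : nat) (M : imat) : bool :=
  all (fun i => all (fun j => inteq (entry M i j) (intZmod.oppz (entry M j i))) (iota 0 n))
    (iota 0 n).

(* Both matrices are skew-symmetric, so comparing their upper parts suffices. *)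
Definition linked (n : nat) (tb : PositiveMap.t imat) (M : imat) (l : link) : bool :=
  let: (i, e, o) := l in
  [&& eqn (size o) n, all (fun k => has (eqn k) o) (iota 0 n) &
  if PositiveMap.find i tb is Some T then
    eqn (size T) n && upper_eq 0 (iperm o M) (if e then iopp T else T)
  else false].

Definition valid (n : nat) (es : seq (nat * nat)) (c : certificate) : bool :=
  (* The default link has an empty reindexing, which [linked] rejects when [n] is positive, so a
     missing link cannot pass. *)
  let tb := table c.1 in let d := (1%positive, false, [::]) in
  all (fun p => iskew n p.1 &&
    all (fun k => linked n tb (imut n k p.1) (nth d p.2 k)) (iota 0 n)) c.1 &&
  all2 (linked n tb) [seq oriented n ps | ps <- orientations es] c.2.

(* Compact encoding of the certificates: constructors without type arguments   *)
(* keep the terms small enough to be stored and checked.                      *)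
Inductive word := WNil | W0 of word | W1 of word | W2 of word | W3 of word
  | W4 of word | W5 of word | W6 of word | W7 of word | W8 of word.
Inductive links := LNil | LCons of positive & bool & word & links.
Inductive reps := RNil | RCons of word & links & reps.
Inductive encoded := Encoded of reps & links.

Definition word_cons (d : nat) : word -> word :=
  match d with 0 => W0 | 1 => W1 | 2 => W2 | 3 => W3 | 4 => W4 | 5 => W5 | 6 => W6
             | 7 => W7 | _ => W8 end.

Definition digit_of_int (x : int) : nat :=
  match x with Posz m => m | Negz m => m + 3 end.

Definition encode_links : seq link -> links :=
  foldr (fun l => LCons l.1.1 l.1.2 (foldr word_cons WNil l.2)) LNil.

Definition encode (c : certificate) : encoded :=
  Encoded (foldr (fun p => RCons
      (foldr (fun x => word_cons (digit_of_int x)) WNil (flatten p.1))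
      (encode_links p.2)) RNil c.1) (encode_links c.2).

Fixpoint digits (w : word) : seq nat :=
  match w with
  | WNil => [::] | W0 w => 0 :: digits w | W1 w => 1 :: digits w
  | W2 w => 2 :: digits w | W3 w => 3 :: digits w | W4 w => 4 :: digits w
  | W5 w => 5 :: digits w | W6 w => 6 :: digits w | W7 w => 7 :: digits w
  | W8 w => 8 :: digits w
  end.

Definition int_of_digit (d : nat) : int :=
  match d with 0 | 1 | 2 => Posz d | 3 => Negz 0 | _ => Negz 1 end.

Fixpoint decode_links (ls : links) : seq link :=
  if ls is LCons i e w ls' then (i, e, digits w) :: decode_links ls' else [::].

Fixpoint decode_reps (n : nat) (rs : reps) : seq (imat * seq link) :=
  if rs is RCons w ls rs' then
    (reshape (nseq n n) (map int_of_digit (digits w)), decode_links ls) :: decode_reps n rs'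
  else [::].

Definition decode (n : nat) (c : encoded) : certificate :=
  let: Encoded rs ls := c in (decode_reps n rs, decode_links ls).

(** The search is run once and its result stored; the validity lemmas only check that result. *)
Definition cert_E6 := Eval vm_compute in encode (generate 6 (chain 5 ++ [:: (2, 5)])).
Definition cert_E7 := Eval vm_compute in encode (generate 7 (chain 6 ++ [:: (2, 6)])).
Definition cert_E8 := Eval vm_compute in encode (generate 8 (chain 7 ++ [:: (2, 7)])).
Definition cert_extE6 := Eval vm_compute in encode (generate 7 (chain 5 ++ [:: (2, 5); (5, 6)])).
Definition cert_extE7 := Eval vm_compute in encode (generate 8 (chain 7 ++ [:: (3, 7)])).
Definition cert_extE8 := Eval vm_compute in encode (generate 9 (chain 8 ++ [:: (2, 8)])).

Lemma valid_E6 : valid 6 (chain 5 ++ [:: (2, 5)]) (decode 6 cert_E6).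
Proof. by vm_compute. Qed.
Lemma valid_E7 : valid 7 (chain 6 ++ [:: (2, 6)]) (decode 7 cert_E7).
Proof. by vm_compute. Qed.
Lemma valid_E8 : valid 8 (chain 7 ++ [:: (2, 7)]) (decode 8 cert_E8).
Proof. by vm_compute. Qed.
Lemma valid_extE6 : valid 7 (chain 5 ++ [:: (2, 5); (5, 6)]) (decode 7 cert_extE6).
Proof. by vm_compute. Qed.
Lemma valid_extE7 : valid 8 (chain 7 ++ [:: (3, 7)]) (decode 8 cert_extE7).
Proof. by vm_compute. Qed.
Lemma valid_extE8 : valid 9 (chain 8 ++ [:: (2, 8)]) (decode 9 cert_extE8).
Proof. by vm_compute. Qed.

Import Order.TTheory GRing.Theory Num.Theory.
Local Open Scope ring_scope.

(** * Mutations *)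

Definition posp (x : int) : int := Num.max x 0.

Lemma posp_ge0 x : 0 <= posp x. Proof. rewrite /posp; lia. Qed.

Lemma pospB x : x = posp x - posp (- x). Proof. rewrite /posp; lia. Qed.

Lemma normr_posp x : `|x| = posp x + posp (- x). Proof. rewrite /posp; lia. Qed.

(** Writing x = [x]_+ - [-x]_+ and |x| = [x]_+ + [-x]_+ removes the division by 2, and identities
    between mutations become polynomial. *)
Lemma mutationE n (k i j : 'I_n) (B : 'M[int]_n) : i != k -> j != k ->
  mutation k B i j = B i j + posp (B i k) * posp (B k j)
                     - posp (- B i k) * posp (- B k j).
Proof.
move=> /negPf ik /negPf jk; rewrite mxE ik jk /= -addrA; congr (_ + _).
apply: (@mulfI _ 2) => //; rewrite mutation_half_exact !normr_posp.
move: (pospB (B i k)) (pospB (B k j)).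
move: (posp (B i k)) (posp (- B i k)) (posp (B k j)) (posp (- B k j)).
by move=> a a' b b' -> ->; ring.
Qed.

Lemma mutation_rowE n (k i j : 'I_n) (B : 'M[int]_n) :
  (i == k) || (j == k) -> mutation k B i j = - B i j.
Proof. by move=> h; rewrite mxE h. Qed.

Section Basics.
Variable n : nat.
Implicit Types B C : 'M[int]_n.

Lemma skewE B : skew_symmetric B <-> forall i j, B i j = - B j i.
Proof.
split=> [/matrixP h i j|h]; first by have := h j i; rewrite !mxE.
by apply/matrixP => i j; rewrite !mxE h.
Qed.

Lemma skew_diag B i : skew_symmetric B -> B i i = 0.
Proof. by move/skewE/(_ i i); lia. Qed.

Lemma skew_mutation B k : skew_symmetric B -> skew_symmetric (mutation k B).
Proof.
move/skewE=> h; apply/skewE => i j.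
have [ij|] := boolP ((i == k) || (j == k)).
  by rewrite (mutation_rowE B ij) (@mutation_rowE _ _ j i) 1?orbC // -(h i j).
rewrite negb_or => /andP[ik jk]; rewrite !mutationE //.
by rewrite (h i j) (h i k) (h k j) !opprK; ring.
Qed.

Lemma mutation_opp B k : mutation k (- B) = - mutation k B.
Proof.
apply/matrixP => i j; rewrite [RHS]mxE.
have [ij|] := boolP ((i == k) || (j == k)); first by rewrite !mutation_rowE ?mxE.
by rewrite negb_or => /andP[ik jk]; rewrite !mutationE // !mxE !opprK; ring.
Qed.

Lemma mutationK B k : skew_symmetric B -> mutation k (mutation k B) = B.
Proof.
move=> h; apply/matrixP => i j.
have [ij|] := boolP ((i == k) || (j == k)); first by rewrite !mutation_rowE // opprK.
rewrite negb_or => /andP[ik jk]; rewrite mutationE // [mutation k B i j]mutationE //.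
by rewrite !(mutation_rowE (k := k)) ?eqxx ?orbT // !opprK; ring.
Qed.

Definition mutations (ks : seq 'I_n) B := foldl (fun M k => mutation k M) B ks.

Lemma skew_mutations ks B : skew_symmetric B -> skew_symmetric (mutations ks B).
Proof. by elim: ks B => //= k ks IH B h; apply/IH/skew_mutation. Qed.

Lemma mutations_opp ks B : mutations ks (- B) = - mutations ks B.
Proof. by elim: ks B => //= k ks IH B; rewrite mutation_opp IH. Qed.

Lemma mutations_cat s t B : mutations (s ++ t) B = mutations t (mutations s B).
Proof. exact: foldl_cat. Qed.

Lemma mutations_inj ks B C : skew_symmetric B -> skew_symmetric C ->
  mutations ks B = mutations ks C -> B = C.
Proof.
elim: ks B C => //= k ks IH B C hB hC.
move/IH=> h; rewrite -(mutationK k hB) h ?mutationK //; exact: skew_mutation.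
Qed.

(** * Finiteness as boundedness of the entries, and periodicity *)

Definition bounded_class B (m : nat) :=
  forall ks i j, (`|mutations ks B i j| <= m)%N.

Lemma nedgesE B i j : skew_symmetric B -> nedges B i j = `|B i j|%N.
Proof. by move/skewE/(_ j i); rewrite /nedges /narrows; case: ifP; case: ifP; lia. Qed.

Lemma mutation_class_finite_bounded B : skew_symmetric B ->
  mutation_class_finite B -> exists m, bounded_class B m.
Proof.
move=> skB [reps hr].
exists (\max_(R <- reps) \max_i \max_j nedges R i j)%N => ks i j.
have [|R Rr [s hs]] := hr (mutations ks B); first by exists ks.
rewrite -nedgesE; last exact: skew_mutations.
rewrite {1}/nedges -2!hs -/(nedges R (s i) (s j)).
apply: leq_trans (leq_bigmax_seq _ Rr isT).
apply: leq_trans (leq_bigmax (s i)) => /=.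
exact: (leq_bigmax (F := fun j => nedges R (s i) j) (s j)).
Qed.

Definition matrix_code (m : nat) (B : 'M[int]_n) : {ffun 'I_n * 'I_n -> 'I_(m + m).+1} :=
  [ffun p => inord `|(B p.1 p.2 + m%:Z)%R|%N].

Lemma matrix_codeK m B i j : (`|B i j| <= m)%N -> B i j = (matrix_code m B (i, j) : nat)%:Z - m%:Z.
Proof. by move=> h; rewrite ffunE inordK /=; lia. Qed.

Lemma bounded_mutation_class_finite B m :
  bounded_class B m -> mutation_class_finite B.
Proof.
move=> hm.
exists [seq \matrix_(i, j) ((f (i, j) : nat)%:Z - m%:Z)
       | f : {ffun 'I_n * 'I_n -> 'I_(m + m).+1}] => C [ks ->].
exists (mutations ks B); last by exists 1%g => i j; rewrite !perm1.
apply/mapP; exists (matrix_code m (mutations ks B)); first by rewrite mem_enum.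
by apply/matrixP => i j; rewrite mxE -matrix_codeK.
Qed.

(* Pigeonhole on the bounded matrices, and then injectivity of mutations. *)
Lemma mutations_periodic B m l : skew_symmetric B -> bounded_class B m ->
  exists2 T, (0 < T)%N & iter T (mutations l) B = B.
Proof.
move=> skB hm.
have itE t M : iter t (mutations l) M = mutations (flatten (nseq t l)) M.
  elim: t => //= t IH; rewrite IH.
  have -> : l ++ flatten (nseq t l) = flatten (nseq t l) ++ l.
    by elim: t {IH} => [|t IH] /=; rewrite ?cats0 // -catA -IH.
  by rewrite mutations_cat.
pose N := #|{ffun 'I_n * 'I_n -> 'I_(m + m).+1}|.
pose f (t : 'I_N.+1) := matrix_code m (iter t (mutations l) B).
have /injectivePn[a [b ab fab]] : ~~ injectiveb f.
  by apply/negP => /injectiveP/leq_card; rewrite card_ord ltnn.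
wlog ltab : a b ab fab / (a < b)%N.
  by move=> H; case: (ltngtP a b) => h; [exact: (H a b)|apply: (H b a) => //; rewrite eq_sym|rewrite (ord_inj h) eqxx in ab].
have eqab : iter a (mutations l) B = iter b (mutations l) B.
  apply/matrixP => i j; rewrite (@matrix_codeK m _ i j) ?itE // [RHS](@matrix_codeK m _ i j) ?itE //.
  by rewrite -!itE -/(f a) fab.
exists (b - a)%N; first by rewrite subn_gt0.
rewrite itE; apply/esym/(@mutations_inj (flatten (nseq a l))) => //.
  exact: skew_mutations.
by rewrite -!itE -iterD subnKC // ltnW.
Qed.

End Basics.

(** * Sweeps along an acyclic subquiver *)

(** The rank counts ancestors: along an arrow from i to j they are inherited, and j itself is new,
    as otherwise there would be an oriented cycle. *)
Lemma acyclic_rank n (B : 'M[int]_n) : quiver_acyclic B ->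
  exists h : 'I_n -> int, forall i j, 0 < B i j -> h i < h j.
Proof.
move=> acB; pose e := [rel x y : 'I_n | (0 < narrows B x y)%N].
exists (fun i => #|[pred y | connect e y i]|%:Z) => i j Bij.
have eij : e i j by rewrite /= /narrows Bij; lia.
rewrite ltz_nat; apply/proper_card/properP; split.
  by apply/subsetP => y; rewrite !inE => /connect_trans; apply; apply: connect1.
exists j; rewrite !inE ?connect0 //; apply/negP => /connectP[p pp ij].
by have /acB : cycle e (j :: p) by rewrite /= rcons_path pp -ij.
Qed.

Section Sweep.
Variables (n : nat) (h : 'I_n -> int) (l : seq 'I_n) (delta : 'I_n -> nat) (x : 'I_n).
Hypothesis l_uniq : uniq l.
Hypothesis l_sorted : sorted (fun i j => h i <= h j) l.
Hypothesis l_delta : forall k, (k \in l) = (0 < delta k)%N.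
Hypothesis x_l : x \notin l.

Section OneSweep.
Variable M : 'M[int]_n.
Hypothesis M_skew : skew_symmetric M.
Hypothesis M_rank : {in l &, forall i j, 0 < M i j -> h i < h j}.
Hypothesis M_delta :
  {in l, forall k, (2 * delta k <= \sum_j `|M k j| * delta j)%N}.

Definition potential (N : 'M[int]_n) : int := \sum_j (delta j)%:Z * N x j.

(* The quiver on [l] after reversing the arrows between [p] and [l \ p]. *)
Definition flipped (p : seq 'I_n) (N : 'M[int]_n) := {in l &, forall i j,
  N i j = if (i \in p) (+) (j \in p) then - M i j else M i j}.

(** In the quiver of [M] the arrows of [l] entering k come from the prefix [p]; once [p] has been
    mutated they leave k instead. *)
Lemma flipped_source p k q N : l = p ++ k :: q -> flipped p N ->
  {in l, forall j, 0 <= N k j}.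
Proof.
move=> lE fN j jl; have kl : k \in l by rewrite lE mem_cat mem_head orbT.
have kp : k \notin p by move: l_uniq; rewrite lE cat_uniq /= negb_or => /and3P[_ /andP[]].
rewrite fN // (negPf kp) /=.
have tr : transitive (fun i j : 'I_n => h i <= h j) by move=> a b c; apply: le_trans.
move: l_sorted; rewrite sorted_pairwise // lE pairwise_cat pairwise_cons.
case/and4P=> /allrelP hp _ /allP hq _; case: ifP => jp.
  have hjk := hp j k jp (mem_head _ _).
  move/skewE: M_skew => ->; rewrite opprK leNgt; apply/negP => hh.
  by have := M_rank kl jl; move/skewE: M_skew => ->; lia.
have hkj : h k <= h j.
  move: jl; rewrite lE mem_cat jp inE => /= /predU1P[->//|]; exact: hq.
rewrite leNgt; apply/negP => hh.
by have := M_rank jl kl; move/skewE: M_skew => ->; lia.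
Qed.

(** No path inside [l] passes through the source k, so the mutation only reverses the arrows at
    k. *)
Lemma flipped_mutation p k q N : l = p ++ k :: q -> skew_symmetric N ->
  flipped p N -> flipped (rcons p k) (mutation k N).
Proof.
move=> lE skN fN i j il jl; have kl : k \in l by rewrite lE mem_cat mem_head orbT.
have kp : k \notin p by move: l_uniq; rewrite lE cat_uniq /= negb_or => /and3P[_ /andP[]].
have sk : forall j, j \in l -> 0 <= N k j by apply: flipped_source lE fN.
rewrite !mem_rcons !inE; have [->|ik] := eqVneq i k.
  rewrite mutation_rowE ?eqxx //; have [->|jk] := eqVneq j k.
    by rewrite !skew_diag ?oppr0.
  by rewrite fN // (negPf kp) /=; case: ifP => _; rewrite ?opprK.
have [->|jk] := eqVneq j k.
  by rewrite mutation_rowE ?eqxx ?orbT // fN // (negPf kp) /= addbF addbT; case: ifP; rewrite ?opprK.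
rewrite mutationE //= -fN // /posp.
have /skewE/(_ i k) eik := skN; have := sk i il; have := sk j jl.
rewrite eik opprK => hj hi; rewrite [Num.max (- N k i) _]max_r; last by lia.
by rewrite [Num.max (- N k j) _]max_r; lia.
Qed.

(** The entry at k changes sign, and every other b_xj with j in [l] gains [b_xk]_+ |b_kj|. The
    hypothesis [M_delta] at k bounds the total gain below by 2 delta_k [b_xk]_+, and [b_xk]_+ - b_xk
    = [-b_xk]_+. *)
Lemma potential_mutation p k q N : l = p ++ k :: q -> skew_symmetric N ->
  flipped p N ->
  potential N + 2 * (delta k)%:Z * posp (- N x k) <= potential (mutation k N).
Proof.
move=> lE skN fN; have kl : k \in l by rewrite lE mem_cat mem_head orbT.
have xk : x != k by apply: contraNneq x_l => ->.
have sk : forall j, j \in l -> 0 <= N k j by apply: flipped_source lE fN.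
have rowE j : (delta j)%:Z * mutation k N x j = (delta j)%:Z *
    (N x j + posp (N x k) * `|M k j| - (if j == k then 2 * N x k else 0)).
  have [jl|] := boolP (j \in l); last first.
    by rewrite l_delta -eqn0Ngt => /eqP ->; rewrite !mul0r.
  congr (_ * _); have [->|jk] := eqVneq j k.
    by rewrite mutation_rowE ?eqxx ?orbT // (skew_diag _ M_skew) normr0; lia.
  rewrite mutationE //.
  have -> : `|M k j| = posp (N k j).
    have := sk j jl; rewrite fN // /posp; case: ifP => _; lia.
  have -> : posp (- N k j) = 0 by have := sk j jl; rewrite /posp; lia.
  by rewrite mulr0.
have := M_delta kl; rewrite -lez_nat PoszM raddf_sum /= => hk.
rewrite /potential (eq_bigr _ (fun j _ => rowE j)).
under [leRHS]eq_bigr => j _ do rewrite mulrBr mulrDr.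
rewrite sumrB big_split /= -addrA lerD2l.
have -> : \sum_i (delta i)%:Z * (if i == k then 2 * N x k else 0) =
          2 * (delta k)%:Z * N x k.
  rewrite (bigD1 k) //= eqxx big1 ?addr0; first by ring.
  by move=> j /negPf ->; rewrite mulr0.
have -> : \sum_i (delta i)%:Z * (posp (N x k) * `|M k i|) =
   posp (N x k) * \sum_i (`|M k i|%N * delta i)%N%:Z.
  by rewrite mulr_sumr; apply: eq_bigr => i _; rewrite PoszM abszE; ring.
have := ler_wpM2l (posp_ge0 (N x k)) hk.
set S := \sum_i _; have := pospB (N x k).
move: (posp (N x k)) (posp (- N x k)) => a b ->; lia.
Qed.

Lemma flipped_prefix p q : l = p ++ q -> flipped p (mutations p M).
Proof.
elim/last_ind: p q => [|p k IH] q lE; first by move=> i j _ _.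
move: lE; rewrite cat_rcons => lE; rewrite -cats1 mutations_cat /= cats1.
apply: flipped_mutation lE _ (IH _ lE); exact: skew_mutations.
Qed.

Lemma potential_prefix p r q : l = p ++ r ++ q ->
  potential (mutations p M) <= potential (mutations (p ++ r) M).
Proof.
elim/last_ind: r q => [|r k IH] q lE; first by rewrite cats0.
move: lE; rewrite cat_rcons => lE; apply: le_trans (IH _ lE) _.
rewrite -cats1 catA [in leRHS]mutations_cat /=.
move: lE; rewrite catA => lE.
have := potential_mutation lE (skew_mutations _ M_skew) (flipped_prefix lE).
have := posp_ge0 (- mutations (p ++ r) M x k); nia.
Qed.

(** After a full sweep each arrow inside [l] has been reversed twice. *)
Lemma sweep_eq : {in l &, forall i j, mutations l M i j = M i j}.
Proof.
move=> i j il jl; rewrite (@flipped_prefix l [::]) ?cats0 // il jl //.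
Qed.

Lemma potential_sweep : potential M <= potential (mutations l M).
Proof. by apply: (@potential_prefix [::] l [::]); rewrite cats0. Qed.

(** Mutations at vertices of [p], which are not joined to [x], leave the row of [x] unchanged on
    [l]. The entry at k is therefore still negative when its turn comes, and the gain there is
    positive. *)
Lemma potential_sweep_lt p k q : l = p ++ k :: q ->
  {in p, forall i, M x i = 0} -> M x k < 0 ->
  potential M < potential (mutations l M).
Proof.
move=> lE px xk0.
have rowE r : {subset r <= p} -> forall s, l = r ++ s ->
    {in l, forall j, mutations r M x j = M x j}.
  elim/last_ind: r => [|r i IH] rp s lE' j jl //.
  have ip : i \in p by apply: rp; rewrite mem_rcons mem_head.
  have {}IH : {in l, forall j, mutations r M x j = M x j}.
    apply: (IH _ (i :: s)); last by rewrite -cat_rcons.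
    by move=> a ar; apply: rp; rewrite mem_rcons inE ar orbT.
  have il : i \in l by rewrite lE mem_cat ip.
  have xi : x != i by apply: contraNneq x_l => ->.
  rewrite -cats1 mutations_cat /=; have [->|ji] := eqVneq j i.
    by rewrite mutation_rowE ?eqxx ?orbT // IH // px // oppr0.
  by rewrite mutationE // !IH // (px i ip) oppr0 [posp 0]maxxx !mul0r addr0 subr0.
have lE' : l = rcons p k ++ q by rewrite cat_rcons.
have kl : k \in l by rewrite lE mem_cat mem_head orbT.
apply: (@lt_le_trans _ _ (potential (mutations (rcons p k) M))); last first.
  rewrite [in leRHS]lE'; apply: (@potential_prefix _ _ [::]); by rewrite cats0.
apply: (@lt_le_trans _ _ (potential (mutations p M)
     + 2 * (delta k)%:Z * posp (- mutations p M x k))).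
  rewrite (rowE _ _ _ lE) //; apply: (@le_lt_trans _ _ (potential (mutations p M))).
    exact: (@potential_prefix [::] p (k :: q)).
  by rewrite ltrDl mulr_gt0 // /posp; [move: kl; rewrite l_delta|]; lia.
rewrite -cats1 mutations_cat /=.
by apply: potential_mutation lE _ (flipped_prefix lE); apply: skew_mutations.
Qed.

End OneSweep.
End Sweep.

Lemma no_subadditive_neg n (B : 'M[int]_n) m (h : 'I_n -> int)
    (delta : 'I_n -> nat) (x k0 : 'I_n) :
  skew_symmetric B -> (forall i j, 0 < B i j -> h i < h j) ->
  bounded_class B m -> delta x = 0%N -> (0 < delta k0)%N -> B x k0 < 0 ->
  (forall k, (0 < delta k)%N -> (2 * delta k <= \sum_j `|B k j| * delta j)%N) ->
  False.
Proof.
move=> skB hB hm dx dk0 xk0 dB.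
pose le_h := fun i j : 'I_n => h i <= h j.
pose l := sort le_h [seq k <- enum 'I_n | (0 < delta k)%N].
have lu : uniq l by rewrite sort_uniq filter_uniq ?enum_uniq.
have ls : sorted le_h l by apply: sort_sorted => i j; apply: le_total.
have ld k : (k \in l) = (0 < delta k)%N by rewrite mem_sort mem_filter mem_enum andbT.
have xl : x \notin l by rewrite ld dx.
have [T T0 TB] := mutations_periodic l skB hm.
pose same M := skew_symmetric M /\ {in l &, forall i j, M i j = B i j}.
have sameS M : same M ->
    same (mutations l M) /\ potential delta x M <= potential delta x (mutations l M).
  case=> skM MB.
  have Mr : {in l &, forall i j, 0 < M i j -> h i < h j} by move=> i j il jl; rewrite MB //; apply: hB.
  have Md : {in l, forall k, (2 * delta k <= \sum_j `|M k j| * delta j)%N}.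
    move=> k kl; have := kl; rewrite ld => /dB; congr (_ <= _)%N.
    apply: eq_bigr => j _; have [jl|] := boolP (j \in l); first by rewrite MB.
    by rewrite ld -eqn0Ngt => /eqP ->; rewrite !muln0.
  split; last exact: (potential_sweep (h := h)).
  split; first exact: skew_mutations.
  by move=> i j il jl; rewrite (sweep_eq lu ls xl) // MB.
have sameI t M : same M -> same (iter t (mutations l) M) /\
    potential delta x M <= potential delta x (iter t (mutations l) M).
  move=> sM; elim: t => [|t [IH1 IH2]] //=.
  by have [? ?] := sameS _ IH1; split=> //; apply: le_trans IH2 _.
have sB : same B by [].
have k0l : k0 \in l by rewrite ld.
have [p [k [q [lE xk px]]]] : exists p k q,
    [/\ l = p ++ k :: q, B x k != 0 & {in p, forall i, B x i = 0}].
  have: has (fun k => B x k != 0) l by apply/hasP; exists k0 => //; rewrite lt_eqF.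
  move: (l) => s /split_find[k p q xk Np]; exists p, k, q; rewrite cat_rcons.
  by split=> // i ip; apply/eqP; apply: contraNT Np => xi; apply/hasP; exists i.
have kl : k \in l by rewrite lE mem_cat mem_head orbT.
(* Otherwise the arrows from k0 to x and from x to k give h k0 < h k, although k precedes k0 in
   [l]. *)
have {}xk : B x k < 0.
  rewrite lt_neqAle xk leNgt; apply/negP => xk_gt0.
  have k0p : k0 \notin p by apply: contraTN xk0 => /px ->; rewrite ltxx.
  have : h k <= h k0.
    move: ls; rewrite sorted_pairwise; last by move=> a b c; apply: le_trans.
    rewrite lE pairwise_cat pairwise_cons => /and4P[_ _ /allP hq _].
    by move: k0l; rewrite lE mem_cat (negPf k0p) inE => /predU1P[->//|/hq].
  have := hB _ _ xk_gt0; have : 0 < B k0 x by move/skewE: skB => ->; lia.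
  by move/hB; lia.
have lt1 : potential delta x B < potential delta x (mutations l B).
  apply: (potential_sweep_lt lu ls ld xl) lE px xk => //.
  - by move=> i j _ _; apply: hB.
  - by move=> i; rewrite ld; apply: dB.
(* The remaining T - 1 sweeps cannot lower the potential, yet they lead back to [B]. *)
have [_] := sameI T.-1 _ (sameS _ sB).1.
by rewrite -iterSr prednK // TB leNgt lt1.
Qed.

(** If the arrow goes from [x] to [k0], the argument is applied to the opposite quiver, with the
    opposite rank. *)
Lemma no_subadditive n (B : 'M[int]_n) m (delta : 'I_n -> nat) (x k0 : 'I_n) :
  skew_symmetric B -> quiver_acyclic B -> bounded_class B m ->
  delta x = 0%N -> (0 < delta k0)%N -> B x k0 != 0 ->
  (forall k, (0 < delta k)%N -> (2 * delta k <= \sum_j `|B k j| * delta j)%N) ->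
  False.
Proof.
move=> skB /acyclic_rank[h hB] hm dx dk0 + dB.
case: ltgtP => // xk0 _; first exact: (no_subadditive_neg skB hB hm dx dk0).
apply: (@no_subadditive_neg _ (- B) m (fun i => - h i) delta x k0) => //.
- by apply/skewE => i j; rewrite !mxE; move/skewE: skB => ->.
- by move=> i j; rewrite mxE ltrN2 => hij; apply: hB; move/skewE: skB => ->.
- by move=> ks i j; rewrite mutations_opp mxE abszN.
- by rewrite mxE oppr_lt0.
- move=> k dk; apply: leq_trans (dB k dk) _.
  by apply/eq_leq/eq_bigr => j _; rewrite mxE abszN.
Qed.

(** * Triangulated quivers *)

(** The sides are numbers, listed in cyclic order. Numbers that label no vertex of the quiver act as
    boundary sides. *)
Definition triangle := (nat * nat * nat)%type.

Definition sides (T : triangle) := [:: T.1.1; T.1.2; T.2].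

Definition turn (T : triangle) (u v : nat) : int :=
  let: (a, b, c) := T in
  ((u == a) && (v == b))%:Z + ((u == b) && (v == c))%:Z + ((u == c) && (v == a))%:Z.

Definition tarrow (T : triangle) (u v : nat) : int := turn T u v - turn T v u.

Definition occ (L : seq triangle) (u : nat) : nat := \sum_(T <- L) count_mem u (sides T).

Definition tsum (L : seq triangle) (u v : nat) : int := \sum_(T <- L) tarrow T u v.

Lemma tarrow_rot a b c : tarrow (b, c, a) =2 tarrow (a, b, c).
Proof. by move=> u v; rewrite /tarrow /turn; ring. Qed.

Lemma tarrow_rev a b c u v : tarrow (a, c, b) u v = - tarrow (a, b, c) u v.
Proof. by rewrite /tarrow /turn; do 6! case: (_ == _). Qed.

Lemma tarrowC T u v : tarrow T u v = - tarrow T v u.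
Proof. by rewrite /tarrow; ring. Qed.

Lemma tsumC L u v : tsum L u v = - tsum L v u.
Proof. by rewrite /tsum -sumrN; apply: eq_bigr => T _; rewrite -tarrowC. Qed.

Lemma tsum_self L u : tsum L u u = 0.
Proof. by have := tsumC L u u; lia. Qed.

Lemma tarrow_out T u v : u \notin sides T -> tarrow T u v = 0.
Proof.
case: T => [[a b] c]; rewrite !inE !negb_or /= => /and3P[/negPf ua /negPf ub /negPf uc].
by rewrite /tarrow /turn ua ub uc !andbF.
Qed.

Lemma tsum_out L u v : occ L u = 0%N -> tsum L u v = 0.
Proof.
move=> o0; rewrite /tsum big_seq big1 // => T TL; apply: tarrow_out.
rewrite -has_pred1 has_count -leqNgt leqn0.
by move/eqP: o0; rewrite /occ sum_nat_seq_eq0 => /allP/(_ _ TL).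
Qed.

Lemma occ_cons T L u : occ (T :: L) u = (count_mem u (sides T) + occ L u)%N.
Proof. exact: big_cons. Qed.

Lemma tsum_cons T L u v : tsum (T :: L) u v = tarrow T u v + tsum L u v.
Proof. exact: big_cons. Qed.

Lemma eq_excl (a b u : nat) : a != b -> (u == a) && (u == b) = false.
Proof. by move=> ab; apply/negP => /andP[/eqP-> /eqP E]; rewrite E eqxx in ab. Qed.

Lemma tarrow_le1 T u v : uniq (sides T) -> `|tarrow T u v| <= (count_mem u (sides T))%:Z.
Proof.
case: T => [[a b] c]; rewrite /= !inE !negb_or => /and3P[/andP[ab ac] bc _].
rewrite /tarrow /turn !(eq_sym _ u) addn0.
move: (eq_excl u ab) (eq_excl u ac) (eq_excl u bc).
move: (eq_excl v ab) (eq_excl v ac) (eq_excl v bc).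
by do 6! case: (_ == _).
Qed.

Section Corner.
Variables (x a b : nat).
Hypotheses (xa : x != a) (xb : x != b).

Lemma tarrow_corner u v : u != x -> v != x -> tarrow (x, a, b) u v =
  (u == a)%:Z * (v == b)%:Z - (u == b)%:Z * (v == a)%:Z.
Proof.
move=> /negPf ux /negPf vx; rewrite /tarrow /turn ux vx.
by do 4! case: (_ == _).
Qed.

Lemma tarrow_to u : u != x -> tarrow (x, a, b) u x = (u == b)%:Z - (u == a)%:Z.
Proof.
move=> /negPf ux; rewrite /tarrow /turn ux eqxx (negPf xa) (negPf xb).
by do 2! case: (_ == _).
Qed.

Lemma tarrow_from v : v != x -> tarrow (x, a, b) x v = (v == a)%:Z - (v == b)%:Z.
Proof. by move=> vx; rewrite tarrowC tarrow_to // opprB. Qed.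

Lemma tarrow_self : tarrow (x, a, b) x x = 0.
Proof. by rewrite /tarrow subrr. Qed.
End Corner.

Section Triangulated.
Variable n : nat.
Implicit Types (B : 'M[int]_n) (f : 'I_n -> nat) (L : seq triangle).

Definition fiber f u := #|[pred i | f i == u]|.

(* A vertex of the quiver is mapped to a side: a side shared by two vertices  *)
(* encodes the two arcs at a puncture, and then it lies on one triangle only. *)
Definition admissible f L :=
  all (fun T => uniq (sides T)) L /\ forall u, (fiber f u + occ L u <= 3)%N.

Definition tmatrix f L : 'M[int]_n := \matrix_(i, j) tsum L (f i) (f j).

Definition triangulated B := exists f L, admissible f L /\ B = tmatrix f L.

Lemma skew_tmatrix f L : skew_symmetric (tmatrix f L).
Proof. by apply/skewE => i j; rewrite !mxE tsumC. Qed.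

Lemma fiber_gt0 f i : (0 < fiber f (f i))%N.
Proof. by apply/card_gt0P; exists i; rewrite inE eqxx. Qed.

(** A labelled side lies on at most two triangles, and each contributes at most 1. *)
Lemma triangulated_le2 B i j : triangulated B -> (`|B i j| <= 2)%N.
Proof.
case=> f [L [[Lu Lf] ->]]; rewrite mxE.
have : (occ L (f i) <= 2)%N by have := Lf (f i); have := fiber_gt0 f i; lia.
apply: leq_trans; rewrite -lez_nat abszE /tsum; apply: le_trans (ler_norm_sum _ _ _) _.
rewrite /occ raddf_sum /= big_seq [leRHS]big_seq; apply: ler_sum => T TL.
by rewrite tarrow_le1 //; move/allP: Lu; apply.
Qed.

Lemma admissible_perm f L L' : perm_eq L L' -> admissible f L -> admissible f L'.
Proof.
move=> LL [Lu Lf]; split; first by rewrite -(perm_all _ LL).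
by move=> u; rewrite /occ -(perm_big _ LL).
Qed.

Lemma tmatrix_perm f L L' : perm_eq L L' -> tmatrix f L = tmatrix f L'.
Proof. by move=> LL; apply/matrixP => i j; rewrite !mxE /tsum (perm_big _ LL). Qed.

Lemma mutation_row0 B k : skew_symmetric B -> (forall j, B k j = 0) -> mutation k B = B.
Proof.
move=> /skewE skB B0; apply/matrixP => i j.
have B0' i' : B i' k = 0 by rewrite skB B0 oppr0.
have [/orP[]/eqP->|] := boolP ((i == k) || (j == k)).
- by rewrite mutation_rowE ?eqxx // B0 oppr0.
- by rewrite mutation_rowE ?eqxx ?orbT // B0' oppr0.
rewrite negb_or => /andP[ik jk]; rewrite mutationE // B0 B0' oppr0.
by rewrite [posp 0]maxxx !mul0r addr0 subr0.
Qed.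

Lemma fresh_side f L : exists y, forall z, (y <= z)%N ->
  fiber f z = 0%N /\ occ L z = 0%N.
Proof.
exists (\max_i f i + \max_(T <- L) \max_(u <- sides T) u).+1 => z yz; split.
  apply: eq_card0 => i; rewrite !inE; apply/negP => /eqP fz.
  by have := leq_bigmax (F := f) i; lia.
apply/eqP; rewrite /occ sum_nat_seq_eq0; apply/allP => T TL; apply/implyP => _.
rewrite eqn0Ngt -has_count has_pred1; apply/negP => zT.
have h1 : (z <= \max_(u <- sides T) u)%N by apply: (leq_bigmax_seq (F := id) _ zT).
have h2 : (\max_(u <- sides T) u <= \max_(T' <- L) \max_(u <- sides T') u)%N.
  exact: (leq_bigmax_seq (F := fun T => \max_(u <- sides T) u)%N _ TL).
lia.
Qed.
Lemma fiber_ge f u (s : seq 'I_n) :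
  uniq s -> all (fun i => f i == u) s -> (size s <= fiber f u)%N.
Proof.
move=> su /allP sf; rewrite -(card_uniqP su); apply: subset_leq_card.
by apply/subsetP => i /sf; rewrite inE.
Qed.

(** Rotating a triangle that contains [x] puts [x] first. The list changes, but not the data [occ]
    and [tsum] on which the matrix and admissibility rest. *)
Lemma corner L x : all (fun T => uniq (sides T)) L -> (0 < occ L x)%N ->
  exists a b R, [/\ uniq [:: x; a; b], all (fun T => uniq (sides T)) R,
    forall u, occ L u = occ ((x, a, b) :: R) u &
    forall u v, tsum L u v = tsum ((x, a, b) :: R) u v].
Proof.
move=> Lu; rewrite lt0n /occ sum_nat_seq_neq0 => /hasP[T TL /=].
rewrite -lt0n -[(_ + _)%N]/(count_mem x (sides T)) -has_count has_pred1 => xT.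
have LT := perm_to_rem TL; have Ru := Lu; rewrite (perm_all _ LT) /= in Ru.
case/andP: Ru => Tu Ru; case: T TL xT LT Ru Tu => [[p q] r] _ xT LT Ru Tu.
have [a [b [ab oE tE]]] : exists a b, [/\ uniq [:: x; a; b],
    forall u, count_mem u (sides (p, q, r)) = count_mem u [:: x; a; b] &
    tarrow (p, q, r) =2 tarrow (x, a, b)].
  move: xT Tu; rewrite /sides /= !inE => /or3P[]/eqP-> Tu.
  - by exists q, r; split=> //; move: Tu; rewrite /= !inE.
  - exists r, p; split; last by move=> u v; rewrite [RHS]tarrow_rot.
      by move: Tu; rewrite /= !inE; lia.
    by move=> u /=; lia.
  - exists p, q; split; last by move=> u v; rewrite tarrow_rot.
      by move: Tu; rewrite /= !inE; lia.
    by move=> u /=; lia.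
exists a, b, (rem (p, q, r) L); split=> // [u|u v].
  by rewrite /occ (perm_big _ LT) !big_cons; congr (_ + _)%N; apply: oE.
by rewrite /tsum (perm_big _ LT) /= !big_cons tE.
Qed.

Lemma occ_corner x a b u :
  count_mem u (sides (x, a, b)) = ((u == x) + (u == a) + (u == b))%N.
Proof. by rewrite /= !(eq_sym _ u); lia. Qed.

Section Mutate.
Variables (f : 'I_n -> nat) (k : 'I_n) (R : seq triangle).
Let x := f k.
Hypothesis Rx : occ R x = 0%N.
Let Rx1 u : tsum R x u = 0. Proof. exact: tsum_out. Qed.
Let Rx2 u : tsum R u x = 0. Proof. by rewrite tsumC tsum_out ?oppr0. Qed.

(** The ordinary flip: [x] is a diagonal of the quadrilateral with sides a, b, c, d and is replaced
    by the other diagonal. As a != d and b != c, no arrows at [x] cancel. *)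
Lemma triangulated_flip a b c d :
  uniq [:: x; a; b] -> uniq [:: x; c; d] -> a != d -> b != c ->
  (forall i, f i = x -> i = k) ->
  admissible f [:: (x, a, b), (x, c, d) & R] ->
  triangulated (mutation k (tmatrix f [:: (x, a, b), (x, c, d) & R])).
Proof.
rewrite /= !inE !negb_or !andbT => /andP[/andP[xa xb] ab] /andP[/andP[xc xd] cd] ad bc fk [Lu Lf].
exists f, [:: (x, b, c), (x, d, a) & R]; split.
  split; first by move: Lu; rewrite /= !inE; lia.
  by move=> u; have := Lf u; rewrite !occ_cons !occ_corner; lia.
have fx i : i != k -> f i != x by apply: contraNneq => /fk ->.
have Bik i : i != k -> tmatrix f [:: (x, a, b), (x, c, d) & R] i k =
    (f i == b)%:Z - (f i == a)%:Z + ((f i == d)%:Z - (f i == c)%:Z).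
  by move=> /fx ix; rewrite mxE !tsum_cons -/x Rx2 !tarrow_to // addr0.
have skB := skew_tmatrix f [:: (x, a, b), (x, c, d) & R].
have posE i : posp ((f i == b)%:Z - (f i == a)%:Z + ((f i == d)%:Z - (f i == c)%:Z))
    = (f i == b)%:Z + (f i == d)%:Z /\
  posp (- ((f i == b)%:Z - (f i == a)%:Z + ((f i == d)%:Z - (f i == c)%:Z)))
    = (f i == a)%:Z + (f i == c)%:Z.
  move: (eq_excl (f i) ab) (eq_excl (f i) cd) (eq_excl (f i) ad) (eq_excl (f i) bc).
  by rewrite /posp; do 4! case: (_ == _).
apply/matrixP => i j; rewrite [RHS]mxE.
have [->|ik] := eqVneq i k.
  rewrite mutation_rowE ?eqxx // -(proj1 (skewE _) skB).
  have [->|jk] := eqVneq j k; first by rewrite skew_diag // tsum_self.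
  rewrite Bik // !tsum_cons -/x Rx1 !tarrow_from ?fx //; lia.
have [->|jk] := eqVneq j k.
  rewrite mutation_rowE ?eqxx ?orbT // Bik // !tsum_cons -/x Rx2 !tarrow_to ?fx //; lia.
rewrite mutationE // (proj1 (skewE _) skB k j) opprK !Bik //.
have [-> ->] := posE i; have [-> ->] := posE j.
rewrite mxE !tsum_cons !tarrow_corner ?fx //; ring.
Qed.

(** The sides [x] and [b] are two arcs to a puncture in a digon with sides [a] and [d]. After the
    flip both arcs are parallel, which is encoded by letting the vertices over [b] share the side
    [x] in a single triangle. *)
Lemma triangulated_close a b d :
  uniq [:: x; a; b] -> uniq [:: x; b; d] -> a != d ->
  (forall i, f i = x -> i = k) ->
  admissible f [:: (x, a, b), (x, b, d) & R] ->
  triangulated (mutation k (tmatrix f [:: (x, a, b), (x, b, d) & R])).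
Proof.
rewrite /= !inE !negb_or !andbT => /andP[/andP[xa xb] ab] /andP[/andP[_ xd] bd] ad fk [Lu Lf].
have ba : b != a by rewrite eq_sym.
have fx i : i != k -> f i != x by apply: contraNneq => /fk ->.
pose g i := if f i == b then x else f i.
have gk : g k = x by rewrite /g (negPf xb).
have occ_b : (fiber f b <= 1)%N.
  by have := Lf b; rewrite !occ_cons !occ_corner eqxx; lia.
have Rb i : f i == b -> forall u, tsum R b u = 0.
  move=> /eqP fib u; apply: tsum_out; have := fiber_gt0 f i; rewrite fib.
  by have := Lf b; rewrite !occ_cons !occ_corner eqxx; lia.
exists g, ((x, d, a) :: R); split.
  split; first by move: Lu; rewrite /= !inE; lia.
  move=> u; have := Lf u; rewrite !occ_cons !occ_corner.
  have [->|ux] := eqVneq u x.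
    rewrite Rx (negPf xa) (negPf xb) (negPf xd) => _ /=.
    suff : (fiber g x <= 1 + fiber f b)%N by lia.
    rewrite -(card1 k) -cardUI; apply: leq_trans (leq_addr _ _).
    apply: subset_leq_card; apply/subsetP => i; rewrite !inE /g.
    by case: (eqVneq (f i) b) => [_|_ /eqP/fk->]; rewrite ?eqxx ?orbT.
  have : (fiber g u <= fiber f u)%N.
    apply: subset_leq_card; apply/subsetP => i; rewrite !inE /g.
    by case: ifP => // _; rewrite eq_sym (negPf ux).
  lia.
have skB := skew_tmatrix f [:: (x, a, b), (x, b, d) & R].
have Bik i : i != k -> tmatrix f [:: (x, a, b), (x, b, d) & R] i k =
    (f i == d)%:Z - (f i == a)%:Z.
  by move=> /fx ix; rewrite mxE !tsum_cons -/x Rx2 !tarrow_to // addr0; lia.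
have posE i : posp ((f i == d)%:Z - (f i == a)%:Z) = (f i == d)%:Z /\
              posp (- ((f i == d)%:Z - (f i == a)%:Z)) = (f i == a)%:Z.
  by move: (eq_excl (f i) ad); rewrite /posp; do 2! case: (_ == _).
have rowE j : j != k -> tmatrix g ((x, d, a) :: R) k j =
    (f j == d)%:Z - (f j == a)%:Z.
  move=> jk; rewrite mxE tsum_cons gk Rx1 addr0 /g.
  case: eqVneq => [->|jb]; first by rewrite tarrow_self (negPf ba) (negPf bd).
  by rewrite tarrow_from ?fx.
have skG := skew_tmatrix g ((x, d, a) :: R).
apply/matrixP => i j; have [->|ik] := eqVneq i k.
  rewrite mutation_rowE ?eqxx // -(proj1 (skewE _) skB).
  have [->|jk] := eqVneq j k; first by rewrite !skew_diag.
  by rewrite Bik // rowE.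
have [->|jk] := eqVneq j k.
  by rewrite mutation_rowE ?eqxx ?orbT // Bik // (proj1 (skewE _) skG) rowE.
rewrite mutationE // (proj1 (skewE _) skB k j) opprK !Bik //.
have [-> ->] := posE i; have [-> ->] := posE j.
rewrite [tmatrix f _ i j]mxE !tsum_cons !tarrow_corner ?fx // mxE tsum_cons /g.
case: (eqVneq (f i) b) => [ib|ib]; case: (eqVneq (f j) b) => [jb|jb].
- by rewrite ib jb tarrow_self Rx1 (Rb i) ?ib ?eqxx // (negPf ba) (negPf bd) /= !mul0r !mulr0.
- by rewrite ib tarrow_from ?fx // Rx1 (Rb i) ?ib ?eqxx // (negPf ba) (negPf bd) /=; ring.
- by rewrite jb tarrow_to ?fx // Rx2 tsumC (Rb j) ?jb ?eqxx // (negPf ba) (negPf bd) /=; ring.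
- by rewrite tarrow_corner ?fx //; rewrite /= ?(mulr0, mul0r); ring.
Qed.

(** The inverse of [triangulated_close]: of the pair k, j at a puncture, j is moved to a fresh side
    [y], and the triangle is divided in two. *)
Lemma triangulated_open a b j : uniq [:: x; a; b] -> j != k -> f j = x ->
  (forall i, f i = x -> i = k \/ i = j) -> admissible f ((x, a, b) :: R) ->
  triangulated (mutation k (tmatrix f ((x, a, b) :: R))).
Proof.
rewrite /= !inE !negb_or !andbT => /andP[/andP[xa xb] ab] jk fj fkj [Lu Lf].
have [y0 y0P] := fresh_side f ((x, a, b) :: R).
have {y0P} [y [yf yx ya yb yR]] : exists y,
    [/\ forall i, f i != y, x != y, a != y, b != y & occ R y = 0%N].
  have [fy oy] := y0P _ (leqnn y0); exists y0; move: oy; rewrite occ_cons occ_corner.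
  move=> oy; split; try by lia.
  by move=> i; apply/negP => /eqP fi; have := fiber_gt0 f i; rewrite fi fy.
have [yx' ya' yb'] : [/\ y != x, y != a & y != b] by rewrite !(eq_sym y).
have fx i : i != k -> i != j -> f i != x.
  by move=> ik ij; apply: contraTneq isT => /fkj[] E; rewrite E eqxx in ik ij.
have kj : k == j = false by rewrite eq_sym (negPf jk).
pose g i := if i == j then y else f i.
have Ry u : tsum R y u = 0 by apply: tsum_out.
have Ry' u : tsum R u y = 0 by rewrite tsumC Ry oppr0.
exists g, [:: (x, b, y), (x, y, a) & R]; split.
  split; first by move: Lu; rewrite /= !inE; lia.
  move=> u; have := Lf u; rewrite !occ_cons !occ_corner.
  have [->|uy] := eqVneq u y.
    rewrite yR (eq_sym y x) (eq_sym y a) (eq_sym y b) (negPf yx) (negPf ya) (negPf yb) => _ /=.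
    suff : (fiber g y <= 1)%N by lia.
    rewrite -(card1 j); apply: subset_leq_card; apply/subsetP => i; rewrite !inE /g.
    by case: ifP => // _; rewrite (negPf (yf i)).
  have [->|ux] := eqVneq u x.
    rewrite Rx (negPf xa) (negPf xb) => _ /=.
    suff : (fiber g x <= 1)%N by lia.
    rewrite -(card1 k); apply: subset_leq_card; apply/subsetP => i; rewrite !inE /g.
    case: (eqVneq i j) => [_|ij]; first by rewrite eq_sym (negPf yx).
    by case: (eqVneq i k) => // ik; rewrite (negPf (fx _ ik ij)).
  have : (fiber g u <= fiber f u)%N.
    apply: subset_leq_card; apply/subsetP => i; rewrite !inE /g.
    by case: ifP => // _; rewrite eq_sym (negPf uy).
  lia.
have skB := skew_tmatrix f ((x, a, b) :: R).
have skG := skew_tmatrix g [:: (x, b, y), (x, y, a) & R].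
have Bik i : i != k -> i != j -> tmatrix f ((x, a, b) :: R) i k =
    (f i == b)%:Z - (f i == a)%:Z.
  by move=> ik ij; rewrite mxE tsum_cons -/x Rx2 tarrow_to ?fx // addr0.
have Bjk : tmatrix f ((x, a, b) :: R) j k = 0.
  by rewrite mxE fj -/x tsum_self.
have Bij i : i != k -> i != j -> tmatrix f ((x, a, b) :: R) i j =
    (f i == b)%:Z - (f i == a)%:Z.
  by move=> ik ij; rewrite mxE fj -/x tsum_cons Rx2 tarrow_to ?fx // addr0.
have Gik i : i != k -> i != j -> tmatrix g [:: (x, b, y), (x, y, a) & R] i k =
    (f i == a)%:Z - (f i == b)%:Z.
  move=> ik ij; rewrite mxE !tsum_cons /g kj (negPf ij) -/x Rx2 !tarrow_to ?fx //.
  by rewrite (negPf (yf i)); lia.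
have Gjk : tmatrix g [:: (x, b, y), (x, y, a) & R] j k = 0.
  rewrite mxE !tsum_cons /g kj eqxx -/x Rx2 !tarrow_to //.
  by rewrite (negPf ya') (negPf yb') eqxx.
have Gij i : i != k -> i != j -> tmatrix g [:: (x, b, y), (x, y, a) & R] i j =
    (f i == b)%:Z - (f i == a)%:Z.
  move=> ik ij; rewrite mxE !tsum_cons /g eqxx (negPf ij) Ry'.
  rewrite !tarrow_corner ?fx // (negPf (yf i)) eqxx.
  by rewrite (negPf ya') (negPf yb'); lia.
have posE i : posp ((f i == b)%:Z - (f i == a)%:Z) = (f i == b)%:Z /\
              posp (- ((f i == b)%:Z - (f i == a)%:Z)) = (f i == a)%:Z.
  by move: (eq_excl (f i) ab); rewrite /posp; do 2! case: (_ == _).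
have Gii i i' : i != k -> i != j -> i' != k -> i' != j ->
    tmatrix g [:: (x, b, y), (x, y, a) & R] i i' = tsum R (f i) (f i').
  move=> ik ij i'k i'j; rewrite mxE !tsum_cons /g (negPf ij) (negPf i'j).
  rewrite !tarrow_corner ?fx // (negPf (yf i)) (negPf (yf i')) /= ?(mulr0, mul0r); ring.
have Bii i i' : i != k -> i != j -> i' != k -> i' != j ->
    tmatrix f ((x, a, b) :: R) i i' =
    (f i == a)%:Z * (f i' == b)%:Z - (f i == b)%:Z * (f i' == a)%:Z + tsum R (f i) (f i').
  by move=> ik ij i'k i'j; rewrite mxE !tsum_cons tarrow_corner ?fx.
have skE := proj1 (skewE _).
have skM := skew_mutation k skB.
apply/matrixP => i i'; have [->|ik] := eqVneq i k.
  rewrite mutation_rowE ?eqxx // -(skE _ _ skB) (skE _ _ skG).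
  have [->|i'k] := eqVneq i' k; first by rewrite !skew_diag ?oppr0.
  have [->|i'j] := eqVneq i' j; first by rewrite Bjk Gjk oppr0.
  by rewrite Bik // Gik //; lia.
have [->|i'k] := eqVneq i' k.
  rewrite mutation_rowE ?eqxx ?orbT //.
  have [->|ij] := eqVneq i j; first by rewrite Bjk Gjk oppr0.
  by rewrite Bik // Gik //; lia.
have [->|ij] := eqVneq i j.
  have [->|i'j] := eqVneq i' j; first by rewrite !skew_diag.
  rewrite mutationE // Bjk oppr0 [posp 0]maxxx !mul0r addr0 subr0.
  by rewrite (skE _ _ skB) (skE _ _ skG) Bij // Gij.
have [->|i'j] := eqVneq i' j.
  rewrite mutationE // (skE _ _ skB k j) Bjk !oppr0 [posp 0]maxxx !mulr0 addr0 subr0.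
  by rewrite Bij // Gij.
rewrite mutationE // (skE _ _ skB k i') opprK !Bik //.
have [-> ->] := posE i; have [-> ->] := posE i'.
rewrite Bii // Gii //; ring.
Qed.

End Mutate.

(** The cases are given by the number of triangles at [x] and of vertices over it: no triangle, a
    pair at a puncture, two triangles, or one triangle. *)
Lemma triangulated_mutation B k : triangulated B -> triangulated (mutation k B).
Proof.
case=> f [L [fL ->]]; set x := f k.
case: (posnP (occ L x)) => [Lx|Lx].
  rewrite mutation_row0; first by exists f, L.
    exact: skew_tmatrix.
  by move=> j; rewrite mxE tsum_out.
have change L' L'' : all (fun T => uniq (sides T)) L'' -> (forall u, occ L' u = occ L'' u) ->
    (forall u v, tsum L' u v = tsum L'' u v) -> admissible f L' ->
    admissible f L'' /\ tmatrix f L' = tmatrix f L''.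
  move=> Lu oE tE [_ Lf]; split; last by apply/matrixP => i j; rewrite !mxE tE.
  by split=> // u; rewrite -oE.
have [a [b [R [ab Ru oE tE]]]] := corner fL.1 Lx.
have [{}fL ->] : admissible f ((x, a, b) :: R) /\ tmatrix f L = tmatrix f ((x, a, b) :: R).
  by apply: change => //; rewrite /= Ru andbT.
have [xa xb] : x != a /\ x != b by move: ab; rewrite /= !inE; lia.
have xo : (fiber f x + (1 + occ R x) <= 3)%N.
  by have := fL.2 x; rewrite occ_cons occ_corner eqxx (negPf xa) (negPf xb).
case: (leqP (fiber f x) 1) => fx; last first.
  have Rx : occ R x = 0%N by lia.
  have [j jk fj] : exists2 j, j != k & f j = x.
    have /card_gt1P[i [j [/eqP fi /eqP fj ij]]] := fx.
    by case: (eqVneq i k) ij => [->|ik _]; [rewrite eq_sym; exists j|exists i].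
  apply: (triangulated_open Rx ab jk fj) fL => i fi.
  case: (eqVneq i k) => [|ik]; [by left|case: (eqVneq i j) => [|ij]; [by right|]].
  have := @fiber_ge f x [:: i; j; k]; rewrite /= !inE negb_or ik ij jk fi fj !eqxx => /(_ isT isT); lia.
have fk i : f i = x -> i = k.
  move=> fi; apply/eqP/negPn/negP => ik.
  have := @fiber_ge f x [:: i; k]; rewrite /= !inE ik fi !eqxx => /(_ isT isT); lia.
(* If b = c and a = d, the two triangles cancel and row [k] is zero; one equality alone closes a
   puncture; neither is an ordinary flip. *)
have flip c d R' : occ R' x = 0%N -> uniq [:: x; c; d] ->
    admissible f [:: (x, a, b), (x, c, d) & R'] ->
    triangulated (mutation k (tmatrix f [:: (x, a, b), (x, c, d) & R'])).
  move=> R'x cd fR; case: (eqVneq b c) cd fR => [<-|bc]; case: (eqVneq a d) => [<-|ad] cd fR.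
  - rewrite mutation_row0; [|exact: skew_tmatrix|]; first by do 2!eexists; split; first exact: fR.
    move=> j; rewrite mxE !tsum_cons [tsum _ _ _]tsum_out // addr0.
    by rewrite tarrow_rev addNr.
  - exact: triangulated_close.
  - have sw : perm_eq [:: (x, a, b), (x, c, a) & R'] [:: (x, c, a), (x, a, b) & R'].
      by apply/seq.permP => q /=; rewrite addnCA.
    rewrite (tmatrix_perm f sw); apply: triangulated_close => //; first by rewrite eq_sym.
    exact: admissible_perm sw fR.
  - exact: triangulated_flip.
case: (posnP (occ R x)) => Rx; last first.
  have [c [d [R' [cd R'u oE' tE']]]] := corner Ru Rx.
  have R'x : occ R' x = 0%N.
    by move: xo; rewrite oE' occ_cons occ_corner eqxx; have := fiber_gt0 f k; rewrite -/x; lia.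
  have [|||fR ->] := change ((x, a, b) :: R) [:: (x, a, b), (x, c, d) & R'] _ _ _ fL.
  - by move: ab cd; rewrite /= !inE R'u; lia.
  - by move=> u; rewrite !(occ_cons (x, a, b)) oE'.
  - by move=> u v; rewrite !(tsum_cons (x, a, b)) tE'.
  exact: flip.
(* A side on one triangle receives a second one with two fresh sides; these label no vertex, so the
   matrix is unchanged. *)
have [y yP] := fresh_side f ((x, a, b) :: R).
have yf z i : (y <= z)%N -> f i == z = false.
  by move=> /yP[fz _]; apply/negP => /eqP fi; have := fiber_gt0 f i; rewrite fi fz.
have xy : (x < y)%N by rewrite ltnNge; apply/negP => /(yf x k); rewrite eqxx.
have xyu : uniq [:: x; y; y.+1] by rewrite /= !inE; lia.
have fR : admissible f [:: (x, a, b), (x, y, y.+1) & R].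
  split; first by move: ab xyu; rewrite /= !inE Ru; lia.
  move=> u; rewrite occ_cons occ_cons (occ_corner x y).
  have := fL.2 u; rewrite occ_cons.
  case: (leqP y u) => uy; first by have [-> +] := yP u uy; rewrite occ_cons; lia.
  case: (eqVneq u x) => [->|ux]; last by lia.
  by rewrite Rx occ_corner eqxx (negPf xa) (negPf xb); lia.
have -> : tmatrix f ((x, a, b) :: R) = tmatrix f [:: (x, a, b), (x, y, y.+1) & R].
  apply/matrixP => i j; rewrite !mxE !tsum_cons; congr (_ + _).
  suff -> : tarrow (x, y, y.+1) (f i) (f j) = 0 by rewrite add0r.
  by rewrite /tarrow /turn !(yf y) ?(yf y.+1) // !andbF.
exact: flip.
Qed.

Lemma triangulated_bounded B : triangulated B -> bounded_class B 2.
Proof.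
move=> tB ks i j; apply: triangulated_le2.
by elim: ks B tB => //= k ks IH B tB; apply/IH/triangulated_mutation.
Qed.

End Triangulated.

(** * Triangulations for the diagrams A, D and their extensions *)

Section Build.
Variable n : nat.
Implicit Types (B C : 'M[int]_n) (d : 'I_n -> nat) (f : 'I_n -> nat).

(* [d i] bounds the number of triangles at [i]; a value of at least 2 means   *)
(* that nothing more may be attached to [i].                                  *)
Definition triangulated_slack B d := exists f L, [/\ admissible f L, B = tmatrix f L &
  forall i, (d i <= 1)%N -> (forall j, f j = f i -> j = i) /\ (occ L (f i) <= d i)%N].

Definition arrow_mx (i j : 'I_n) : 'M[int]_n := delta_mx i j - delta_mx j i.

Lemma arrow_mxE (i j p q : 'I_n) : arrow_mx i j p q =
  ((p == i) && (q == j))%:Z - ((p == j) && (q == i))%:Z.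
Proof. by rewrite !mxE; do 2! case: (_ && _). Qed.

Lemma arrow_mxC i j : arrow_mx i j = - arrow_mx j i.
Proof. by rewrite /arrow_mx opprB. Qed.

Lemma slack_triangulated B d : triangulated_slack B d -> triangulated B.
Proof. by case=> f [L [fL BE _]]; exists f, L. Qed.

Lemma slack_eq B d d' : triangulated_slack B d -> d =1 d' -> triangulated_slack B d'.
Proof.
case=> f [L [fL BE df]] dd; exists f, L; split=> // i; rewrite -dd; exact: df.
Qed.

Lemma slack0 : triangulated_slack 0 (fun=> 0%N).
Proof.
exists (@nat_of_ord n), [::]; split=> [||i _].
- split=> // u; rewrite /occ big_nil addn0; apply: (@leq_trans 1); last by [].
  apply/card_le1_eqP => i j; rewrite !inE => /eqP iu /eqP ju.
  by apply: val_inj; rewrite /= iu ju.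
- by apply/matrixP => i j; rewrite !mxE /tsum big_nil.
- by split; [move=> j /val_inj|rewrite /occ big_nil].
Qed.

Lemma slack_opp B d : triangulated_slack B d -> triangulated_slack (- B) d.
Proof.
case=> f [L [[Lu Lf] BE df]]; pose rv (T : triangle) := (T.1.1, T.2, T.1.2).
have oE u : occ (map rv L) u = occ L u.
  by rewrite /occ big_map; apply: eq_bigr => -[[a b] c] _ /=; lia.
exists f, (map rv L); split.
- split; last by move=> u; rewrite oE.
  rewrite all_map; apply: sub_all Lu => -[[a b] c]; rewrite /= !inE; lia.
- rewrite BE; apply/matrixP => i j; rewrite !mxE /tsum big_map -sumrN.
  by apply: eq_bigr => -[[a b] c] _; rewrite -tarrow_rev.
- by move=> i /df; rewrite oE.
Qed.

Lemma fiber_le1 f i : (forall j, f j = f i -> j = i) -> (fiber f (f i) <= 1)%N.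
Proof.
by move=> fi; apply/card_le1_eqP => j k; rewrite !inE => /eqP/fi-> /eqP/fi->.
Qed.

Lemma fresh_sides f L : exists y, [/\ forall i, f i == y = false, occ L y = 0%N & fiber f y = 0%N].
Proof.
have [y /(_ y (leqnn y))[fy oy]] := fresh_side f L; exists y; split=> // i.
by apply/negP => /eqP fi; have := fiber_gt0 f i; rewrite fi fy.
Qed.

(** A triangle whose third side is a fresh boundary side contributes a single arrow. *)
Lemma slack_edge B d i j : triangulated_slack B d -> i != j ->
  (d i <= 1)%N -> (d j <= 1)%N ->
  triangulated_slack (B + arrow_mx i j) (fun k => d k + (k == i) + (k == j))%N.
Proof.
case=> f [L [[Lu Lf] BE df]] ij di dj.
have [fi oi] := df i di; have [fj oj] := df j dj.
have fij : f i != f j by apply: contra_neq ij => /fj.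
have fiE p : (f p == f i) = (p == i) by apply/eqP/eqP => [/fi|->].
have fjE p : (f p == f j) = (p == j) by apply/eqP/eqP => [/fj|->].
have [y [fy oy fy0]] := fresh_sides f L.
have := fy i; have := fy j => jy iy.
exists f, ((f i, f j, y) :: L); split.
- split; first by rewrite /= Lu !inE; lia.
  move=> u; rewrite occ_cons occ_corner; have := Lf u.
  have := fiber_le1 fi; have := fiber_le1 fj.
  case: (eqVneq u (f i)) => [->|ui]; first by rewrite (negPf fij) iy; lia.
  case: (eqVneq u (f j)) => [->|uj]; first by rewrite jy; lia.
  by case: (eqVneq u y) => [->|uy]; lia.
- apply/matrixP => p q; rewrite [RHS]mxE tsum_cons mxE arrow_mxE BE mxE addrC.
  by congr (_ + _); rewrite /tarrow /turn !fiE !fjE !fy !andbF; do 4! case: (_ == _).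
move=> k dk; have [fk ok] := df k ltac:(lia); split=> //.
rewrite occ_cons occ_corner fiE fjE fy; lia.
Qed.

Lemma slack_triangle B d i j k : triangulated_slack B d -> uniq [:: i; j; k] ->
  (d i <= 1)%N -> (d j <= 1)%N -> (d k <= 1)%N ->
  triangulated_slack (B + (arrow_mx i j + arrow_mx j k + arrow_mx k i))
    (fun l => d l + (l == i) + (l == j) + (l == k))%N.
Proof.
rewrite /= !inE negb_or => + /and3P[/andP[ij ik] jk _].
case=> f [L [[Lu Lf] BE df]] di dj dk.
have [fi oi] := df i di; have [fj oj] := df j dj; have [fk ok] := df k dk.
have fiE p : (f p == f i) = (p == i) by apply/eqP/eqP => [/fi|->].
have fjE p : (f p == f j) = (p == j) by apply/eqP/eqP => [/fj|->].
have fkE p : (f p == f k) = (p == k) by apply/eqP/eqP => [/fk|->].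
exists f, ((f i, f j, f k) :: L); split.
- split; first by rewrite /= Lu !inE !fjE !fkE; lia.
  move=> u; rewrite occ_cons occ_corner; have := Lf u.
  have := fiber_le1 fi; have := fiber_le1 fj; have := fiber_le1 fk.
  case: (eqVneq u (f i)) => [->|ui]; first by rewrite fjE fkE (negPf ij) (negPf ik); lia.
  case: (eqVneq u (f j)) => [->|uj]; first by rewrite fkE (negPf jk); lia.
  by case: (eqVneq u (f k)) => [->|uk]; lia.
- apply/matrixP => p q; rewrite [RHS]mxE tsum_cons 3!mxE !arrow_mxE BE mxE addrC.
  by congr (_ + _); rewrite /tarrow /turn !fiE !fjE !fkE; do 6! case: (_ == _).
move=> l dl; have [fl ol] := df l ltac:(lia); split=> //.
rewrite occ_cons occ_corner fiE fjE fkE; lia.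
Qed.

(** The vertex [j] is moved to the side of [i], so one triangle yields both arrows. The added 2
    closes [i] and [j] to further attachments. *)
Lemma slack_twin B d o i j : triangulated_slack B d -> uniq [:: o; i; j] ->
  (d o <= 1)%N -> d i = 0%N -> d j = 0%N ->
  triangulated_slack (B + (arrow_mx o i + arrow_mx o j))
    (fun l => d l + (l == o) + 2 * (l == i) + 2 * (l == j))%N.
Proof.
rewrite /= !inE negb_or => + /and3P[/andP[oi oj] ij _].
case=> f [L [[Lu Lf] BE df]] d_o di dj.
have [fo oo] := df o d_o.
have [fi] := df i ltac:(lia); rewrite di leqn0 => /eqP oi0.
have [fj] := df j ltac:(lia); rewrite dj leqn0 => /eqP oj0.
have foE p : (f p == f o) = (p == o) by apply/eqP/eqP => [/fo|->].
have fiE p : (f p == f i) = (p == i) by apply/eqP/eqP => [/fi|->].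
have fjE p : (f p == f j) = (p == j) by apply/eqP/eqP => [/fj|->].
have [y [fy oy fy0]] := fresh_sides f L.
pose g k := if k == j then f i else f k.
have goE p : (g p == f o) = (p == o).
  rewrite /g; case: (eqVneq p j) => [->|_]; last exact: foE.
  by rewrite foE eq_sym (negPf oi) eq_sym (negPf oj).
have giE p : (g p == f i) = (p == i) || (p == j).
  by rewrite /g; case: (eqVneq p j) => [->|_]; rewrite ?eqxx ?orbT ?orbF ?fiE.
have gy p : (g p == y) = false by rewrite /g; case: ifP.
exists g, ((f o, f i, y) :: L); split.
- split; first by rewrite /= Lu !inE; have := fy i; have := fy o; rewrite fiE; lia.
  move=> u; rewrite occ_cons occ_corner; have := Lf u.
  have fg : u != f i -> (fiber g u <= fiber f u)%N.
    move=> ui; apply: subset_leq_card; apply/subsetP => p; rewrite !inE /g.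
    by case: ifP => // _; rewrite eq_sym (negPf ui).
  case: (eqVneq u (f i)) fg => [-> _|ui fg].
    rewrite oi0 fy eq_sym fiE (negPf oi) => _.
    suff : (fiber g (f i) <= #|[set i; j]|)%N by rewrite cards2; lia.
    by apply: subset_leq_card; apply/subsetP => p; rewrite !inE giE.
  have := fg isT; have := fiber_le1 fo.
  case: (eqVneq u (f o)) => [->|uo]; first by rewrite fy; lia.
  by case: (eqVneq u y) => [->|uy]; lia.
- have gE p q : tsum L (f p) (f q) = tsum L (g p) (g q).
    rewrite /g; case: (eqVneq p j) => [->|pj].
      by rewrite !(tsum_out _ oi0) !(tsum_out _ oj0).
    case: (eqVneq q j) => [->|qj] //.
    by rewrite tsumC (tsum_out _ oj0) tsumC (tsum_out _ oi0).
  apply/matrixP => p q; rewrite [RHS]mxE tsum_cons 2!mxE !arrow_mxE BE mxE addrC gE.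
  congr (_ + _); rewrite /tarrow /turn !goE !giE !gy !andbF /=.
  move: (eq_excl (p : nat) ij) (eq_excl (q : nat) ij).
  by rewrite !val_eqE; do 6! case: (_ == _).
move=> k dk; have kj : k != j by apply/eqP => kj; move: dk; rewrite kj eqxx; lia.
have ki : k != i by apply/eqP => ki; move: dk; rewrite ki eqxx; lia.
have [fk ok] := df k ltac:(lia).
have gk : g k = f k by rewrite /g (negPf kj).
split; last by rewrite gk occ_cons occ_corner foE fiE fy; lia.
move=> p; rewrite gk /g; case: ifP => [_ /fk E|_]; last exact: fk.
by rewrite E eqxx in ki.
Qed.

Definition sign (s : int) := s = 1 \/ s = -1.

Lemma slack_signed_edge B d s i j : triangulated_slack B d -> sign s -> i != j ->
  (d i <= 1)%N -> (d j <= 1)%N ->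
  triangulated_slack (B + s *: arrow_mx i j) (fun k => d k + (k == i) + (k == j))%N.
Proof.
move=> tB [] -> ij di dj; first by rewrite scale1r; apply: slack_edge.
rewrite scaleN1r -arrow_mxC; apply: slack_eq (slack_edge tB _ dj di) _.
  by rewrite eq_sym.
by move=> k /=; rewrite addnAC.
Qed.

(* Two leaves at [o]: they form a pair at a puncture if both arrows leave or   *)
(* enter [o], and otherwise they are two sides of a triangle whose third      *)
(* arrow is cancelled.                                                        *)
Lemma slack_fork B d s t o i j : triangulated_slack B d -> sign s -> sign t ->
  uniq [:: o; i; j] -> (d o <= 1)%N -> d i = 0%N -> d j = 0%N ->
  triangulated_slack (B + (s *: arrow_mx o i + t *: arrow_mx o j))
    (fun l => d l + (l == o) + 2 * (l == i) + 2 * (l == j))%N.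
Proof.
have opposite i' j' B' : triangulated_slack B' d -> uniq [:: o; i'; j'] ->
    (d o <= 1)%N -> d i' = 0%N -> d j' = 0%N ->
    triangulated_slack (B' + (arrow_mx o i' - arrow_mx o j'))
      (fun l => d l + (l == o) + 2 * (l == i') + 2 * (l == j'))%N.
  move=> tB u d_o di dj; have := slack_triangle tB u d_o.
  rewrite di dj => /(_ isT isT) tB'.
  move: u; rewrite /= !inE negb_or => /and3P[/andP[oi oj] ij _].
  have := slack_edge (i := j') (j := i') tB'.
  rewrite di dj !eqxx (eq_sym j' o) (eq_sym i' o) (eq_sym j' i') (negPf oi) (negPf oj) (negPf ij).
  move=> /(_ isT isT isT) tB''.
  rewrite (_ : _ + _ = B' + (arrow_mx o i' + arrow_mx i' j' + arrow_mx j' o) + arrow_mx j' i').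
    by apply: slack_eq tB'' _ => l /=; lia.
  rewrite (arrow_mxC j' o) (arrow_mxC j' i').
  move: (arrow_mx o i') (arrow_mx o j') (arrow_mx i' j') => X Y Z.
  by rewrite -!addrA [Z + _]addrCA subrr addr0.
move=> tB [] -> [] -> u d_o di dj; rewrite ?scale1r ?scaleN1r.
- exact: slack_twin.
- exact: opposite.
- have := @opposite j i B tB; rewrite [- _ + _]addrC => H.
  apply: slack_eq (H _ d_o dj di) _; last by move=> l /=; lia.
  by move: u; rewrite /= !inE (eq_sym j i); lia.
- have := slack_opp (slack_twin (slack_opp tB) u d_o di dj).
  by rewrite opprD opprK opprD.
Qed.

Definition realizes C es := skew_symmetric C /\ forall i j, nedges C i j = diagram_mult es i j.

Lemma realizes_perm C es es' : perm_eq es es' -> realizes C es -> realizes C es'.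
Proof.
by move=> /seq.permP ee [skC CE]; split=> // i j; rewrite CE /diagram_mult ee.
Qed.

Lemma realizes_swap C a b es : realizes C ((a, b) :: es) -> realizes C ((b, a) :: es).
Proof.
move=> [skC CE]; split=> // i j; rewrite CE /diagram_mult /=; congr (_ + _)%N.
by rewrite !xpair_eqE orbC ![(b == _) && _]andbC.
Qed.

(** Peels off one simple edge: its matrix entry is a sign, which gives the orientation. *)
Lemma realizes_cons C (a b : 'I_n) es : a != b -> diagram_mult es a b = 0%N ->
  realizes C ((a : nat, b : nat) :: es) ->
  exists s C', [/\ sign s, realizes C' es & C = C' + s *: arrow_mx a b].
Proof.
move=> ab e0 [skC CE]; have sE := proj1 (skewE _) skC.
have CabE i j : `|C i j|%N = diagram_mult ((a : nat, b : nat) :: es) i j.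
  by rewrite -CE nedgesE.
have mE (i j : 'I_n) : diagram_mult ((a : nat, b : nat) :: es) i j =
    (((a == i) && (b == j) || (a == j) && (b == i)) + diagram_mult es i j)%N.
  by rewrite /diagram_mult /= !xpair_eqE.
have Cab : `|C a b|%N = 1%N by rewrite CabE mE !eqxx e0.
exists (C a b), (C - C a b *: arrow_mx a b); split; [|split|by rewrite subrK].
- by rewrite /sign; lia.
- apply/skewE => i j; rewrite !mxE (sE i j).
  by do 4! case: (_ == _); rewrite /= ?(mulr0, mulr1, subr0, sub0r, subrr); lia.
move=> i j; rewrite nedgesE; last first.
  apply/skewE => i' j'; rewrite !mxE (sE i' j').
  by do 4! case: (_ == _); rewrite /= ?(mulr0, mulr1, subr0, sub0r, subrr); lia.
have -> : (C - C a b *: arrow_mx a b) i j = C i j - C a b * arrow_mx a b i j by rewrite !mxE.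
have := CabE i j; rewrite mE arrow_mxE.
rewrite ![i == _]eq_sym ![j == _]eq_sym.
case: (boolP ((a == i) && (b == j))) => [/andP[/eqP<- /eqP<-] _|_].
  by rewrite (negPf ab) /= e0; lia.
case: (boolP ((a == j) && (b == i))) => [/andP[/eqP<- /eqP<-] _|h].
  by rewrite diagram_multC e0 (sE b) !eqxx /=; lia.
by rewrite [(b == i) && _]andbC (negPf h) /=; lia.
Qed.

Definition degree (es : seq (nat * nat)) (u : nat) : nat :=
  \sum_(e <- es) ((e.1 == u) + (e.2 == u)).

Fixpoint simple (es : seq (nat * nat)) : bool :=
  if es is e :: es' then
    [&& e.1 != e.2, (e.1 < n)%N, (e.2 < n)%N, diagram_mult es' e.1 e.2 == 0%N & simple es']
  else true.

Lemma realizes_nil C : realizes C [::] -> C = 0.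
Proof.
case=> skC CE; apply/matrixP => i j; rewrite mxE.
by have := CE i j; rewrite nedgesE // /diagram_mult /=; lia.
Qed.

Lemma slack_realizes es B C d : triangulated_slack B d -> simple es -> realizes C es ->
  (forall k : 'I_n, (d k + degree es k <= 2)%N) -> triangulated (B + C).
Proof.
elim: es B C d => [|[a b] es IH] B C d tB.
  by move=> _ /realizes_nil -> _; rewrite addr0; apply: slack_triangulated tB.
rewrite [simple _]/= => /and5P[ab an bn /eqP e0 es_simple] CE dE.
pose a' := Ordinal an; pose b' := Ordinal bn.
have dC k : degree ((a, b) :: es) k = ((a == k) + (b == k) + degree es k)%N.
  by rewrite /degree big_cons.
have [s [C' [ss C'E ->]]] := @realizes_cons C a' b' es ab e0 CE.
have da := dE a'; have db := dE b'; rewrite dC eqxx in da; rewrite dC eqxx in db.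
have tB' := @slack_signed_edge B d s a' b' tB ss ab ltac:(lia) ltac:(lia).
rewrite [C' + _]addrC addrA; apply: IH tB' es_simple C'E _ => k.
have := dE k; rewrite dC -!val_eqE /= !(eq_sym (nat_of_ord k)); lia.
Qed.

Definition run m k : seq (nat * nat) := [seq (i, i.+1) | i <- iota m k].

Lemma degree_run m k u :
  degree (run m k) u = ((m <= u < m + k) + (m < u < (m + k).+1))%N.
Proof.
rewrite /degree /run; elim: k m => [|k IH] m; first by rewrite big_nil; lia.
by rewrite /= big_cons IH /=; lia.
Qed.

Lemma diagram_mult_run m k a b : (a < m)%N -> diagram_mult (run m k) a b = 0%N.
Proof.
rewrite /diagram_mult /run count_map => am; apply/eqP; rewrite -leqn0 leqNgt -has_count.
by apply/hasPn => i; rewrite mem_iota /= !xpair_eqE; lia.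
Qed.

Lemma simple_run m k : (m + k < n)%N -> simple (run m k).
Proof.
elim: k m => //= k IH m mk; rewrite diagram_mult_run // IH //; lia.
Qed.

Lemma triangulated_A C : (0 < n)%N -> realizes C (chain n) -> triangulated C.
Proof.
move=> n0 CE; rewrite -[C]add0r; apply: (slack_realizes slack0) CE _.
  by apply: simple_run; lia.
by move=> k; rewrite [chain n]/(run 0 n.-1) degree_run; lia.
Qed.

Lemma triangulated_cycle C : (2 < n)%N -> realizes C (chain n ++ [:: (n.-1, 0%N)]) ->
  triangulated C.
Proof.
move=> n2; rewrite [chain n]/(run 0 n.-1) => CE.
have {}CE : realizes C ((n.-1, 0%N) :: run 0 n.-1).
  by apply: realizes_perm CE; rewrite perm_catC.
rewrite -[C]add0r; apply: (slack_realizes slack0) CE _.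
  rewrite /= simple_run; last by lia.
  rewrite diagram_multC -/(chain n) diagram_mult_chain //; lia.
by move=> k; rewrite /degree big_cons -/(degree _ _) degree_run /=; have := ltn_ord k; lia.
Qed.

Lemma slack_realizes_fork B d C (o i j : 'I_n) es : triangulated_slack B d ->
  uniq [:: o; i; j] -> (d o <= 1)%N -> d i = 0%N -> d j = 0%N ->
  diagram_mult es o i = 0%N -> diagram_mult es o j = 0%N ->
  realizes C [:: (o : nat, i : nat), (o : nat, j : nat) & es] ->
  exists C' D, [/\ realizes C' es, C = C' + D &
    triangulated_slack (B + D) (fun l => d l + (l == o) + 2 * (l == i) + 2 * (l == j))%N].
Proof.
move=> tB u d_o di dj ei ej CE.
have := u; rewrite /= !inE negb_or => /and3P[/andP[oi oj] ij _].
have [|s [C1 [ss C1E ->]]] := realizes_cons oi _ CE.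
  by rewrite diagram_mult_cons ei !xpair_eqE; move: ij oi; rewrite -!val_eqE /=; lia.
have [t [C2 [ts C2E ->]]] := realizes_cons oj ej C1E.
exists C2, (s *: arrow_mx o i + t *: arrow_mx o j); split=> //.
  by rewrite -addrA [t *: _ + _]addrC.
exact: slack_fork.
Qed.

Lemma triangulated_D C : (3 < n)%N ->
  realizes C (chain n.-1 ++ [:: (n - 3, n - 1)]%N) -> triangulated C.
Proof.
move=> n3 CE.
have o_n : (n - 3 < n)%N by lia.
have i_n : (n - 2 < n)%N by lia.
have j_n : (n - 1 < n)%N by lia.
pose o := Ordinal o_n; pose i := Ordinal i_n; pose j := Ordinal j_n.
have {}CE : realizes C [:: (o : nat, i : nat), (o : nat, j : nat) & run 0 (n - 3)].
  apply: realizes_perm CE; rewrite perm_catC /=.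
  have -> : chain n.-1 = run 0 (n - 3) ++ [:: (n - 3, n - 2)%N].
    have -> : chain n.-1 = run 0 (n - 3).+1 by rewrite /chain /run; congr map; congr iota; lia.
    by rewrite /run -addn1 iotaD map_cat /= add0n; congr (_ ++ [:: (_, _)]); lia.
  apply/seq.permP => p /=; rewrite count_cat /=; lia.
have [||||||C' [D [C'E -> tD]]] := slack_realizes_fork slack0 _ _ _ _ _ _ CE => //.
- by rewrite /= !inE -!val_eqE /=; lia.
- by rewrite [diagram_mult _ _ _](@diagram_mult_chain (n - 3).+1) /=; lia.
- by rewrite [diagram_mult _ _ _](@diagram_mult_chain (n - 3).+1) /=; lia.
rewrite addrC -[D]add0r; apply: slack_realizes tD _ C'E _; first by apply: simple_run; lia.
by move=> k; rewrite degree_run -!val_eqE /=; lia.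
Qed.

(** One fork at each end of a path. For m = 4 the forks share their centre, whose two permitted
    triangles are then both used. *)
Lemma triangulated_extended_D m C : n = m.+1 -> (3 < m)%N ->
  realizes C (chain m.-1 ++ [:: (1, m - 1); (m - 3, m)]%N) -> triangulated C.
Proof.
move=> nm m3 CE.
have bound k : (k <= m)%N -> (k < n)%N by rewrite nm ltnS.
pose o1 := Ordinal (bound 1%N ltac:(lia)); pose i1 := Ordinal (bound 0%N ltac:(lia)).
pose j1 := Ordinal (bound (m - 1)%N ltac:(lia)).
pose o2 := Ordinal (bound (m - 3)%N ltac:(lia)).
pose i2 := Ordinal (bound (m - 2)%N ltac:(lia)); pose j2 := Ordinal (bound m ltac:(lia)).
pose es2 := [:: (o2 : nat, i2 : nat), (o2 : nat, j2 : nat) & run 1 (m - 4)].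
have {}CE : realizes C [:: (o1 : nat, i1 : nat), (o1 : nat, j1 : nat) & es2].
  apply: realizes_swap; apply: realizes_perm CE.
  have -> : chain m.-1 = (0, 1)%N :: run 1 (m - 4) ++ [:: (m - 3, m - 2)%N].
    rewrite /chain /run; have -> : m.-1.-1 = (m - 4 + 1).+1 by lia.
    by rewrite /= iotaD map_cat /=; congr (_ :: _ ++ [:: (_, _)]); lia.
  by apply/seq.permP => p /=; rewrite !count_cat /=; lia.
have [||||||C' [D [C'E -> tD]]] := slack_realizes_fork slack0 _ _ _ _ _ _ CE => //.
- by rewrite /= !inE -!val_eqE /=; lia.
- rewrite !diagram_mult_cons diagram_multC diagram_mult_run // !xpair_eqE /=; lia.
- rewrite !diagram_mult_cons !xpair_eqE /=.
  have -> : diagram_mult (run 1 (m - 4)) 1 (m - 1) = 0%N; last by lia.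
  rewrite /diagram_mult /run count_map; apply/eqP; rewrite -leqn0 leqNgt -has_count.
  by apply/hasPn => i; rewrite mem_iota /= !xpair_eqE; lia.
have [||||||C2 [D2 [C2E -> tD2]]] := slack_realizes_fork tD _ _ _ _ _ _ C'E.
- by rewrite /= !inE -!val_eqE /=; lia.
- by rewrite -!val_eqE /=; lia.
- by rewrite -!val_eqE /=; lia.
- by rewrite -!val_eqE /=; lia.
- rewrite /diagram_mult /run count_map; apply/eqP; rewrite -leqn0 leqNgt -has_count.
  by apply/hasPn => i; rewrite mem_iota /= !xpair_eqE; lia.
- rewrite /diagram_mult /run count_map; apply/eqP; rewrite -leqn0 leqNgt -has_count.
  by apply/hasPn => i; rewrite mem_iota /= !xpair_eqE; lia.
rewrite -addrA addrC [D2 + _]addrC -[D]add0r.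
apply: slack_realizes tD2 _ C2E _; first by apply: simple_run; lia.
by move=> k; rewrite degree_run -!val_eqE /=; lia.
Qed.

End Build.

(** * Quivers of exceptional type *)

Definition relabel m n (f : 'I_m -> 'I_n) (B : 'M[int]_n) : 'M[int]_m :=
  \matrix_(i, j) B (f i) (f j).

Lemma mutation_relabel m n (f : 'I_m -> 'I_n) (B : 'M[int]_n) k : injective f ->
  mutation k (relabel f B) = relabel f (mutation (f k) B).
Proof. by move=> fi; apply/matrixP => i j; rewrite !mxE !(inj_eq fi). Qed.

Section Certified.
Variable n : nat.
Implicit Types (M T : imat) (B : 'M[int]_n).

Definition mx_of M : 'M[int]_n := \matrix_(i, j) entry M i j.

Lemma mut_entryE (a c b : int) :
  mut_entry a c b = b + posp a * posp c - posp (- a) * posp (- c).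
Proof. by case: a => a; case: c => c; rewrite /mut_entry /posp; lia. Qed.

Lemma mx_imut (k : 'I_n) M : mx_of (imut n k M) = mutation k (mx_of M).
Proof.
apply/matrixP => i j; rewrite mxE /entry /imut !nth_mkseq //.
have eE (p q : 'I_n) : eqn p q = (p == q) by [].
rewrite !eE; case: ifP => [h|/negbT]; first by rewrite mutation_rowE // mxE.
by rewrite negb_or => /andP[ik jk]; rewrite mutationE // !mxE mut_entryE.
Qed.

Lemma entry_iopp M i j : entry (iopp M) i j = - entry M i j.
Proof.
rewrite /entry /iopp; case: (ltnP i (size M)) => iM.
  rewrite (nth_map [::]) //; case: (ltnP j (size (nth [::] M i))) => jM.
    by rewrite (nth_map (Posz 0)).
  by rewrite nth_default ?size_map // [nth (Posz 0) _ j]nth_default.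
by rewrite !(nth_default [::]) ?size_map // !nth_nil.
Qed.

Lemma entry_iperm o M i j : (i < size o)%N -> (j < size o)%N ->
  entry (iperm o M) i j = entry M (nth 0%N o i) (nth 0%N o j).
Proof.
move=> io jo; rewrite /entry /iperm (nth_map [::]) ?size_map //.
by rewrite (nth_map 0%N) // (nth_map 0%N).
Qed.

Lemma all2_eq (T : Type) (r : T -> T -> bool) s t :
  (forall x y, r x y -> x = y) -> all2 r s t -> s = t.
Proof.
by move=> rP; elim: s t => [|x s IH] [|y t] //= /andP[/rP-> /IH->].
Qed.

Lemma inteqP x y : inteq x y -> x = y.
Proof. by case: x y => x [] y //= /eqnP ->. Qed.

Lemma upper_eqP i0 M T i j : upper_eq i0 M T -> (i < size M)%N -> size M = size T ->
  (i0 + i <= j)%N -> entry M i j = entry T i j.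
Proof.
rewrite /entry; elim: M T i0 i => [|r M IH] [|r' T] i0 [|i] //=.
  move=> /andP[/(all2_eq inteqP) rr _] _ _; rewrite addn0 => ij.
  by rewrite -(subnKC ij) -!nth_drop rr.
move=> /andP[_ /IH{}IH] iM [MT] ij; apply: IH => //; by rewrite addSnnS.
Qed.

Lemma iskew_mx M : iskew n M -> skew_symmetric (mx_of M).
Proof.
move=> /allP sM; apply/skewE => i j; rewrite !mxE.
have /allP/(_ j) := sM i ltac:(by rewrite mem_iota /=).
by rewrite mem_iota /= => /(_ (ltn_ord j))/inteqP.
Qed.

Let d0 : imat * seq link := ([::], [::]).

Lemma tableP (l : seq (imat * seq link)) i T :
  PositiveMap.find i (table l) = Some T ->
  exists2 r, (r < size l)%N & T = (nth d0 l r).1.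
Proof.
rewrite /table; set f := fun p c => _.
suff H p tb : PositiveMap.find i (foldl f (p, tb) l).2 = Some T ->
    PositiveMap.find i tb = Some T \/ exists2 r, (r < size l)%N & T = (nth d0 l r).1.
  by case/H => //; rewrite PositiveMap.gempty.
elim: l p tb => [|[M ms] l IH] p tb /=; first by left.
case/IH => [|[r rl TE]]; last by right; exists r.+1.
case: (Pos.eq_dec i p) => [->|ip].
  by rewrite PositiveMap.gss => -[<-]; right; exists 0%N.
by rewrite PositiveMap.gso //; left.
Qed.

Variable c : certificate.
Variable es : seq (nat * nat).
Hypothesis c_valid : valid n es c.

Let rep r := (nth d0 c.1 r).1.

Definition certified B := exists (f : 'I_n -> 'I_n) (e : bool) r,
  [/\ injective f, (r < size c.1)%N &
      relabel f B = if e then - mx_of (rep r) else mx_of (rep r)].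

Lemma rep_skew r : (r < size c.1)%N -> skew_symmetric (mx_of (rep r)).
Proof.
move=> rl; case/andP: c_valid => /(all_nthP d0)/(_ _ rl)/andP[skr _] _.
exact: iskew_mx.
Qed.

Lemma linked_certified M l : skew_symmetric (mx_of M) -> linked n (table c.1) M l ->
  certified (mx_of M).
Proof.
case: l => -[i e] o skM /and3P[/eqnP so /allP oP].
have io : {subset iota 0 n <= o}.
  by move=> k /oP/hasP[k' ? /eqnP ->].
have oi : (size o <= size (iota 0 n))%N by rewrite size_iota so.
(* A list of length [n] containing 0, ..., n - 1 is a permutation of them. *)
have ou : uniq o := leq_size_uniq (iota_uniq 0 n) io oi.
have on k : k \in o -> (k < n)%N.
  by have [_ <-] := uniq_min_size (iota_uniq 0 n) io oi; rewrite mem_iota.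
case Ti : (PositiveMap.find i _) => [T|] // /andP[/eqnP sT MT].
have [r rl TE] := tableP Ti.
have lt (p : 'I_n) : (nth 0%N o p < n)%N by apply: on; rewrite mem_nth ?so.
exists (fun p => Ordinal (lt p)), e, r; split=> //.
  move=> p q /(congr1 val)/eqP; rewrite /= nth_uniq ?so // => /eqP; exact: val_inj.
have skT : skew_symmetric (if e then - mx_of (rep r) else mx_of (rep r)).
  have := rep_skew rl; case: (e) => // skR.
  by apply/skewE => p q; rewrite !mxE; move/skewE: skR => /(_ p q); rewrite !mxE => ->.
have upper (p q : 'I_n) : (p <= q)%N -> relabel (fun p => Ordinal (lt p)) (mx_of M) p q =
    (if e then - mx_of (rep r) else mx_of (rep r)) p q.
  move=> pq; rewrite !mxE /= -entry_iperm ?so //.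
  rewrite (upper_eqP MT) ?size_map ?so //; last by case: (e); rewrite ?size_map.
  by rewrite TE; case: (e); rewrite ?entry_iopp !mxE.
apply/matrixP => p q; case: (leqP p q) => pq; first exact: upper.
have skR : skew_symmetric (relabel (fun p => Ordinal (lt p)) (mx_of M)).
  by apply/skewE => p' q'; rewrite [LHS]mxE [in RHS]mxE; move/skewE: skM => ->.
by rewrite (proj1 (skewE _) skR) (proj1 (skewE _) skT) upper // ltnW.
Qed.

Lemma relabel_certified f B : injective f -> certified (relabel f B) -> certified B.
Proof.
move=> fi [g [e [r [gi rl E]]]]; exists (f \o g), e, r; split=> //.
  exact: inj_comp.
by rewrite -E; apply/matrixP => i j; rewrite !mxE.
Qed.

Lemma opp_certified B : certified (- B) -> certified B.
Proof.
move=> [g [e [r [gi rl E]]]]; exists g, (~~ e), r; split=> //.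
have -> : relabel g B = - relabel g (- B) by apply/matrixP => i j; rewrite !mxE opprK.
by rewrite E; case: (e); rewrite ?opprK.
Qed.

(** Mutation commutes with relabelling and with sign change, so it is enough to mutate a listed
    matrix, where the certificate provides a link. *)
Lemma mutation_certified B k : certified B -> certified (mutation k B).
Proof.
move=> [f [e [r [fi rl E]]]].
pose k' := invF fi k; have kE : k = f k' by rewrite f_invF.
apply: (relabel_certified fi); rewrite kE -mutation_relabel // E.
suff H : certified (mutation k' (mx_of (rep r))).
  case: (e) => //; apply: opp_certified; rewrite mutation_opp opprK //.
have skr := skew_mutation k' (rep_skew rl); rewrite -mx_imut in skr *.
case/andP: c_valid => /(all_nthP d0)/(_ _ rl)/andP[_ /allP/(_ k') H] _.
by apply: (linked_certified skr); apply: H; rewrite mem_iota /=.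
Qed.

Lemma certified_bounded B : certified B -> exists m, bounded_class B m.
Proof.
pose m := (\max_(r < size c.1) \max_i \max_j `|mx_of (rep r) i j|)%N.
move=> cB; exists m => ks i j.
have {cB} : certified (mutations ks B).
  by elim: ks B cB => //= k ks IH B cB; apply/IH/mutation_certified.
move: (mutations ks B) => C [f [e [r [fi rl E]]]].
have /matrixP/(_ (invF fi i) (invF fi j)) := E; rewrite mxE !f_invF => ->.
apply: leq_trans (leq_bigmax (Ordinal rl)) => /=.
apply: leq_trans (leq_bigmax (invF fi i)) => /=.
apply: leq_trans (leq_bigmax (invF fi j)) => /=.
by case: (e); rewrite ?[(- _ : 'M_n) _ _]mxE ?abszN.
Qed.

Lemma mx_oriented ps (i j : 'I_n) : mx_of (oriented n ps) i j =
  if ((i : nat), (j : nat)) \in ps then 1 else if ((j : nat), (i : nat)) \in ps then -1 else 0.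
Proof. by rewrite mxE /entry /oriented !nth_mkseq. Qed.

Lemma oriented_cons ps (a b : 'I_n) : a != b -> mx_of (oriented n ps) a b = 0 ->
  mx_of (oriented n ((a : nat, b : nat) :: ps)) = mx_of (oriented n ps) + arrow_mx a b.
Proof.
move=> ab; rewrite mx_oriented; case: ifP => // abp; case: ifP => // bap _.
apply/matrixP => i j; rewrite [RHS]mxE !mx_oriented arrow_mxE !inE !xpair_eqE !val_eqE.
case: (boolP ((i == a) && (j == b))) => [/andP[/eqP-> /eqP->]|_] /=.
  by rewrite abp bap (negPf ab).
rewrite [(j == a) && _]andbC; case: (boolP ((i == b) && (j == a))) => [/andP[/eqP-> /eqP->]|_] /=.
  by rewrite abp bap.
by rewrite subrr addr0.
Qed.

Lemma realizes_oriented (C : 'M[int]_n) qs : simple n qs -> realizes C qs ->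
  exists2 ps, ps \in orientations qs & C = mx_of (oriented n ps).
Proof.
elim: qs C => [|[a b] qs IH] C.
  move=> _ /realizes_nil ->; exists [::] => //.
  by apply/matrixP => i j; rewrite mx_oriented mxE.
rewrite [simple _ _]/= => /and5P[ab an bn /eqP e0 qs_simple] CE.
pose a' := Ordinal an; pose b' := Ordinal bn.
have [s [C' [ss C'E ->]]] := @realizes_cons n C a' b' qs ab e0 CE.
have [ps ps_in CP] := IH _ qs_simple C'E.
have C0 : C' a' b' = 0.
  case: C'E => skC /(_ a' b'); rewrite nedgesE // e0; lia.
case: ss => ->; [exists ((a, b) :: ps)|exists ((b, a) :: ps)].
- by rewrite /= mem_cat map_f.
- by rewrite scale1r (oriented_cons (a := a') (b := b')) // -CP.
- by rewrite /= mem_cat [X in _ || X]map_f ?orbT.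
- rewrite scaleN1r -arrow_mxC CP (oriented_cons (a := b') (b := a')) //; first by rewrite eq_sym.
  rewrite -CP; case: C'E => /skewE skC _; by rewrite skC C0 oppr0.
Qed.

Lemma valid_bounded (C : 'M[int]_n) : simple n es -> realizes C es -> exists m, bounded_class C m.
Proof.
move=> es_simple CE; have skC := CE.1.
have [ps ps_in CP] := realizes_oriented es_simple CE; rewrite CP in skC *.
apply: certified_bounded; case/andP: c_valid => _.
elim: (orientations es) ps_in c.2 => //= qs l IH; rewrite inE {CP}.
case/predU1P => [psE|/IH {}IH] [|k ks] //= /andP[h1 h2]; last exact: IH h2.
by rewrite -psE in h1; apply: linked_certified skC h1.
Qed.

End Certified.

(** * The main theorem *)

Lemma bounded_relabel n (f g : 'I_n -> 'I_n) (B : 'M[int]_n) m :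
  cancel f g -> cancel g f -> bounded_class (relabel f B) m -> bounded_class B m.
Proof.
move=> fg gf hm ks i j.
suff E : mutations (map g ks) (relabel f B) = relabel f (mutations ks B).
  by have := hm (map g ks) (g i) (g j); rewrite E mxE !gf.
elim: ks B {hm} => //= k ks IH B.
by rewrite mutation_relabel ?gf ?IH //; apply: can_inj fg.
Qed.

(** Every off-diagonal entry involves the mutated vertex or does not exist, so absolute values are
    invariant. *)
Lemma bounded_le2 n (B : 'M[int]_n) : (n <= 2)%N -> skew_symmetric B ->
  exists m, bounded_class B m.
Proof.
move=> n2 skB; exists (\max_i \max_j `|B i j|)%N => ks i j.
suff -> : `|mutations ks B i j|%N = `|B i j|%N.
  by apply: leq_trans (leq_bigmax i); apply: (leq_bigmax (F := fun j => `|B i j|%N)).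
elim: ks B skB => //= k ks IH B skB; rewrite IH; last exact: skew_mutation.
have [h|] := boolP ((i == k) || (j == k)); first by rewrite mutation_rowE // abszN.
rewrite negb_or => /andP[ik jk]; suff -> : i = j.
  by rewrite !skew_diag //; apply: skew_mutation.
apply: val_inj; move: ik jk; rewrite -!val_eqE /=.
by have := ltn_ord i; have := ltn_ord j; have := ltn_ord k; lia.
Qed.

Lemma dynkin_bounded n es (C : 'M[int]_n) : dynkin_diagram n es -> realizes C es ->
  exists m, bounded_class C m.
Proof.
move=> h; case: h C => [{}n n0|{}n n3|||] C CE.
- by exists 2%N; apply/triangulated_bounded/triangulated_A.
- by exists 2%N; apply/triangulated_bounded/triangulated_D.
- by apply: (valid_bounded valid_E6 _ CE).
- by apply: (valid_bounded valid_E7 _ CE).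
- by apply: (valid_bounded valid_E8 _ CE).
Qed.

Lemma extended_dynkin_bounded n es (C : 'M[int]_n) : extended_dynkin_diagram n es ->
  realizes C es -> exists m, bounded_class C m.
Proof.
move=> h; case: h C => [{}n n1|{}n n3|||] C CE.
(* Here [n] is the index of the diagram: index 1 is the double edge on two vertices, which is not a
   simple cycle. *)
- case: (ltnP 1 n) => n2; last by apply: bounded_le2 CE.1.
  by exists 2%N; apply/triangulated_bounded/triangulated_cycle.
- by exists 2%N; apply/triangulated_bounded/(@triangulated_extended_D _ n).
- by apply: (valid_bounded valid_extE6 _ CE).
- by apply: (valid_bounded valid_extE7 _ CE).
- by apply: (valid_bounded valid_extE8 _ CE).
Qed.

Lemma underlying_graph_realizes n (B : 'M[int]_n) es : skew_symmetric B ->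
  underlying_graph_is B es -> exists f g : 'I_n -> 'I_n,
  [/\ cancel f g, cancel g f & realizes (relabel f B) es].
Proof.
move=> /skewE skB [s sE]; exists (s^-1)%g, s; split.
- exact: permKV.
- exact: permK.
split; first by apply/skewE => i j; rewrite !mxE skB.
by move=> i j; rewrite -[in RHS](permKV s i) -[in RHS](permKV s j) -sE /nedges /narrows !mxE.
Qed.

Lemma bounded_classified n (B : 'M[int]_n) m : (2 < n)%N -> skew_symmetric B ->
  quiver_connected B -> quiver_acyclic B -> bounded_class B m ->
  quiver_dynkin B \/ quiver_extended_dynkin B.
Proof.
move=> n3 skB [n0 conB] acB hm.
have [||||| es h hs] := @graph_classified n (nedges B) (Ordinal n0) => //.
- by move=> i j; rewrite /nedges addnC.
- by move=> i; rewrite nedgesE // skew_diag.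
- move=> delta x k dx dk dB.
  (* By connectedness some edge leaves the support of [delta], whereas the given [x] and [k] need
     not be adjacent. *)
  have [u [v [du dv uv]]] : exists u v, [/\ (0 < delta u)%N, delta v = 0%N & (0 < nedges B u v)%N].
    case: (boolP [exists u, exists v, [&& (0 < delta u)%N, delta v == 0%N & (0 < nedges B u v)%N]]).
      by case/existsP=> u /existsP[v /and3P[? /eqP ? ?]]; exists u, v.
    move=> no; have cl : closed [rel x y | (0 < nedges B x y)%N] [pred u | (0 < delta u)%N].
      move=> u v /= uv; rewrite !inE; apply/idP/idP => d0; rewrite lt0n; apply: contra no => d1.
        by apply/existsP; exists u; apply/existsP; exists v; rewrite d0 d1.
      by apply/existsP; exists v; apply/existsP; exists u; rewrite d0 d1 /nedges addnC.
    by have := closed_connect cl (conB k x); rewrite !inE dk dx.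
  apply: (no_subadditive (x := v) (k0 := u) skB acB hm dv du) => [|j dj].
    by move: uv; rewrite nedgesE //; move/skewE: skB => ->; lia.
  by have := dB j dj; under eq_bigr => l _ do rewrite nedgesE //.
by case: h => h; [left|right]; exists es.
Qed.

Theorem theorem3p5 (n : nat) (B : 'M[int]_n)
    (B_skew : skew_symmetric B)
    (B_connected : quiver_connected B)
    (B_acyclic : quiver_acyclic B) :
  mutation_class_finite B <->
  (quiver_dynkin B \/ quiver_extended_dynkin B \/ (n <= 2)%N).
Proof.
split=> [/(mutation_class_finite_bounded B_skew)[m hm]|h].
  case: (leqP n 2) => n2; first by right; right.
  by case: (bounded_classified n2 B_skew B_connected B_acyclic hm); [left|right; left].
suff [m hm] : exists m, bounded_class B m by apply: bounded_mutation_class_finite hm.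
have relab es : underlying_graph_is B es ->
    (forall C : 'M[int]_n, realizes C es -> exists m, bounded_class C m) ->
    exists m, bounded_class B m.
  move=> /(underlying_graph_realizes B_skew)[f [g [fg gf CE]]] /(_ _ CE)[m hm].
  by exists m; apply: bounded_relabel hm.
case: h => [[es h /relab H]|[[es h /relab H]|n2]].
- by apply: H => C; apply: dynkin_bounded h.
- by apply: H => C; apply: extended_dynkin_bounded h.
- exact: bounded_le2.
Qed.
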